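(* Let $\nu>0$ and $\alpha>2$. For every $s>0$ there exist $N_0>1$ and $b>1$ such that, with $N_k=N_0^{b^k}$ for $k\ge 0$, there exist initial data $X^0\in\mathcal C^\infty$ with $X^0_k>0$ for all $k\ge 0$ and a force $f\in C_t^\infty([0,\infty);\mathcal C^\infty)$ for which the solution $X$ of the forced viscous Obukhov model $$X_k'=-\nu N_k^2X_k+N_{k-1}^\alpha X_{k-1}X_k-N_k^\alpha X_{k+1}^2+f_k,\qquad k\ge 0,\qquad X_{-1}\equiv 0,$$ with $X(0)=X^0$ exhibits finite-time blow-up, i.e. its maximal time of existence satisfies $T_*<\infty$, and moreover $X$ becomes unbounded in $\mathcal C^s$, i.e. $\sup_{0\le t<T_*}\|X(t)\|_s=\infty$.
   Context: Given the increasing sequence of frequency scales $N_k=N_0^{b^k}$ ($k\ge 0$, $N_0>1$, $b>1$), define for $s\in\mathbb R$ the Banach space $\mathcal C^s=\{X:\mathbb N\to\mathbb R:\ \|X\|_s<\infty\}$, where $\mathbb N=\{0,1,2,\dots\}$ and $\|X\|_s:=\sup_{k\ge 0}N_k^s|X_k|$. Define the Fréchet space $\mathcal C^\infty:=\bigcap_{s>0}\mathcal C^s$. The notation $f\in C_t^\infty([0,\infty);\mathcal C^\infty)$ means that $f$ is a smooth function of time with values in $\mathcal C^\infty$ (equivalently, smooth with values in $\mathcal C^\sigma$ for every $\sigma>0$). In the system, the term containing $X_{-1}$ is zero for $k=0$. For $X^0\in\mathcal C^\infty$ and $f\in C_t^\infty([0,\infty);\mathcal C^\infty)$ there is a unique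 local solution $X\in\bigcap_{\sigma>0}C_t([0,T);\mathcal C^\sigma)$ for some $T>0$ with $X(0)=X^0$, and there is a maximal time of existence $T_*\in(0,\infty]$ of the solution in this class. Finite-time blow-up means $T_*<\infty$. *)

(* Defs.v *)
From mathcomp Require Import all_boot all_order all_algebra.
From mathcomp Require Import all_classical all_reals all_analysis.
Import Order.TTheory GRing.Theory Num.Theory.
Import numFieldNormedType.Exports.

Set Implicit Arguments.
Unset Strict Implicit.
Unset Printing Implicit Defensive.

Local Open Scope classical_set_scope.
Local Open Scope ring_scope.

(* Throughout, sequences are total functions [R^nat] and time-dependent
   sequences are total functions [R -> R^nat]; the latter are only ever
   constrained at times of the relevant interval. *)

Definition freq (R : realType) (N0 b : R) : R^nat :=
  fun k => N0 `^ (b ^+ k).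

(* Extended-real valued, equal to [+oo] exactly off the space C^s. *)
Definition wnorm (R : realType) (N : R^nat) (s : R) (x : R^nat) : \bar R :=
  ereal_sup [set ((N k `^ s) * `|x k|)%:E | k in [set: nat]].

Definition in_Cs (R : realType) (N : R^nat) (s : R) : set R^nat :=
  [set x | (wnorm N s x < +oo)%E].

Definition in_Cinfty (R : realType) (N : R^nat) : set R^nat :=
  [set x | forall s : R, 0 < s -> in_Cs N s x].

Definition time_itv (R : realType) (T : \bar R) : set R :=
  [set t | 0 <= t /\ (t%:E < T)%E].

(* Relative to [D], so that the derivative at the left endpoint 0 of a time
   interval is the right derivative. *)
Definition increment_filter (R : realType) (D : set R) (t : R) : set_system R :=
  within [set h | D (t + h)] 0^'.

Definition continuous_in_Cs (R : realType) (N : R^nat) (s : R) (D : set R)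
    (X : R -> R^nat) : Prop :=
  forall t, D t -> in_Cs N s (X t) /\
    wnorm N s (X u - X t) @[u --> within D (nbhs t)] --> 0%E.

(* [Y] is the time derivative of [X] on [D] for the topology of the Frechet
   space C^oo, i.e. with respect to each of the norms of the spaces C^s. *)
Definition Cinfty_derivative (R : realType) (N : R^nat) (D : set R)
    (X Y : R -> R^nat) : Prop :=
  forall t, D t -> forall s : R, 0 < s ->
    wnorm N s (h^-1 *: (X (t + h) - X t) - Y t) @[h --> increment_filter D t]
      --> 0%E.

(* [g n] is the n-th time derivative of [f]. *)
Definition smooth_in_Cinfty (R : realType) (N : R^nat) (D : set R)
    (f : R -> R^nat) : Prop :=
  exists g : nat -> R -> R^nat,
    [/\ forall t, D t -> g 0%N t = f t,
        forall n t, D t -> in_Cinfty N (g n t) &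
        forall n, Cinfty_derivative N D (g n) (g n.+1)].

Definition obukhov_rhs (R : realType) (N : R^nat) (nu alpha : R)
    (F x : R^nat) : R^nat :=
  fun k => - nu * N k ^+ 2 * x k
    + (if k is j.+1 then N j `^ alpha * x j * x k else 0)
    - N k `^ alpha * x k.+1 ^+ 2
    + F k.

Definition obukhov_solution (R : realType) (N : R^nat) (nu alpha : R)
    (X0 : R^nat) (f : R -> R^nat) (T : \bar R) (X : R -> R^nat) : Prop :=
  [/\ X 0 = X0,
      forall s : R, 0 < s -> continuous_in_Cs N s (time_itv T) X &
      forall t k, time_itv T t ->
        h^-1 * (X (t + h) k - X t k) @[h --> increment_filter (time_itv T) t]
          --> obukhov_rhs N nu alpha (f t) (X t) k].

(* [X] is the unique solution and [T] its maximal time of existence: every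
   solution on some [0, T') has T' <= T and is the restriction of [X]. *)
Definition maximal_obukhov_solution (R : realType) (N : R^nat)
    (nu alpha : R) (X0 : R^nat) (f : R -> R^nat) (T : \bar R)
    (X : R -> R^nat) : Prop :=
  [/\ (0 < T)%E,
      obukhov_solution N nu alpha X0 f T X &
      forall (T' : \bar R) (Y : R -> R^nat),
        obukhov_solution N nu alpha X0 f T' Y ->
        (T' <= T)%E /\ forall t, time_itv T' t -> Y t = X t].

(* Main.v *)
(* The force is used only to hold each mode at a tiny amplitude until its turn
   comes.  Put [A_k = N_k^(-sg)] with [0 < sg < s] and [alpha - sg > 2 b], and let
   mode [k+1] take a time [N_k^(dl - (alpha - sg))] to grow, under the exact
   unforced dynamics, from a size exponentially small in [N_k^dl] to [A_(k+1)];
   the growth rate [N_k^alpha A_k] beats the viscous rate [nu N_(k+1)^2].  These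
   times are summable, so the cascade is complete at a finite time [T], before
   which every [C^s] norm level is passed at one of the peaks.

   Writing [X_k = A_k exp (z_k)] with [z_k = 0] at the peak time of mode [k] turns
   the system on the whole of [(-oo, T]] into a fixed point problem: for small
   [dl] and large [N_0], the loss of mode [k] to mode [k+1] is a small perturbation
   of the growth, and the integral operator is a contraction in a weighted sup
   norm once the exponentials are capped; the caps turn out to be inactive.  The
   force is a feedback term carrying a cut-off [1 - chi_k] supported where [X_k] is
   still exponentially small, so all its time derivatives decay faster than any
   power of [N_k], and in each mode it vanishes near [T].  Uniqueness is a
   Gronwall-type estimate in the sup norm, and the peaks make [T] maximal. *)

Require Import Defs.
From mathcomp Require Import all_boot all_order all_algebra.
From mathcomp Require Import all_classical all_reals all_analysis.
From mathcomp Require Import lra ring.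
Import Order.TTheory GRing.Theory Num.Theory.
Import numFieldNormedType.Exports.

Set Implicit Arguments.
Unset Strict Implicit.
Unset Printing Implicit Defensive.

Local Open Scope classical_set_scope.
Local Open Scope ring_scope.

(** * Calculus on the line *)

Lemma is_derive_continuous (R : realType) (f : R -> R) (x df : R) :
  is_derive x 1 f df -> {for x, continuous f}.
Proof.
by move=> [d _]; apply: differentiable_continuous; apply/derivable1_diffP.
Qed.

Lemma mean_value (R : realType) (f df : R -> R) (a b : R) :
  a <= b -> (forall x, a <= x <= b -> is_derive x 1 f (df x)) ->
  exists2 c, a <= c <= b & f b - f a = df c * (b - a).
Proof.
move=> ab fdf.
have fd x : x \in `]a, b[ -> is_derive x 1 f (df x).
  by rewrite in_itv/= => /andP[ax xb]; apply: fdf; rewrite !ltW.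
have fc : {within `[a, b], continuous f}.
  apply: derivable_within_continuous => x; rewrite in_itv/= => /fdf [] //.
have [c cab E] := MVT_segment ab fd fc.
by exists c => //; move: cab; rewrite in_itv.
Qed.

Lemma norm_increment_le (R : realType) (f df : R -> R) (a b Q : R) :
  a <= b -> (forall x, a <= x <= b -> is_derive x 1 f (df x)) ->
  (forall x, a <= x <= b -> `|df x| <= Q) -> `|f b - f a| <= Q * (b - a).
Proof.
move=> ab fdf dfQ; have [c cab ->] := mean_value ab fdf.
by rewrite normrM (@ger0_norm _ (b - a)) ?subr_ge0// ler_wpM2r ?subr_ge0// dfQ.
Qed.

(** Integrating from minus infinity gives one primitive on the whole line. Since [g] vanishes on the
    negative half-line, the integral up to [u] is over the compact [[0, u]], where continuity gives
    integrability. *)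
Lemma primitive_exists (R : realType) (g : R -> R) :
  continuous g -> (forall t, t <= 0 -> g t = 0) ->
  exists F : R -> R, forall t : R, is_derive t 1 F (g t).
Proof.
move=> cg g0.
have ig (u : R) :
    (@lebesgue_measure R).-integrable [set` `]-oo, u]%R] (EFin \o g).
  apply/integrable_mkcond => //.
  have -> : (EFin \o g) \_ [set` `]-oo, u]%R] = (EFin \o g) \_ [set` `[0, u]%R].
    apply/funext => x; rewrite /patch !mem_setE !in_itv/=.
    case: (leP 0 x) => //= x0; case: ifP => // _.
    by rewrite (g0 _ (ltW x0)).
  apply/(iffLR (integrable_mkcond _ _)) => //.
  have h := @continuous_compact_integrable R g `[0, u]%classic
    (@segment_compact R 0 u) (continuous_subspaceT cg).
  exact: h.
exists (fun x => (\int[lebesgue_measure]_(t in [set` `]-oo, x]%R]) g t)%R) => t.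
have tt1 : t < t + 1 by rewrite ltrDl.
have [|d E] := @continuous_FTC1 R g -oo%O t (t + 1) tt1 (ig _) _ (cg t).
  by rewrite ltNyr.
by apply: DeriveDef => //; rewrite -derive1E.
Qed.

(** The intervals of radius [2 * K / 2 ^+ n] around [u n] are nested; the limit is the supremum of
    their left ends. The explicit rate makes the limit uniform in time when this is applied at each
    time. *)
Lemma geometric_limit (R : realType) (u : R^nat) (K : R) :
  (forall n, `|u n.+1 - u n| <= K / 2 ^+ n) ->
  exists l, forall n, `|u n - l| <= 2 * K / 2 ^+ n.
Proof.
move=> uK.
pose a n := u n - 2 * K / 2 ^+ n; pose b n := u n + 2 * K / 2 ^+ n.
have h n : 2 * K / 2 ^+ n.+1 = K / 2 ^+ n.
  by rewrite exprS; field; rewrite expf_neq0.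
have h2 n : 2 * K / 2 ^+ n = K / 2 ^+ n + K / 2 ^+ n by rewrite -mulrA mulrDl !mul1r.
have anS n : a n <= a n.+1.
  by rewrite /a h h2; have := uK n; rewrite ler_norml => /andP[? ?]; lra.
have bnS n : b n.+1 <= b n.
  by rewrite /b h h2; have := uK n; rewrite ler_norml => /andP[? ?]; lra.
have amono := @homo_leq _ a (fun x y => x <= y) lexx (@le_trans _ _) anS.
have bmono m n : (m <= n)%N -> b n <= b m.
  by move/(@homo_leq _ b (fun x y => y <= x) lexx (fun _ _ _ x y => le_trans y x) bnS).
have ab n : a n <= b n.
  rewrite /a /b h2; have := le_trans (normr_ge0 _) (uK n); lra.
have amb m n : a m <= b n.
  rewrite (le_trans (amono _ _ (leq_maxl m n)))// (le_trans (ab _))//.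
  exact/bmono/leq_maxr.
have hs : has_sup (range a).
  by split; [exists (a 0%N); exists 0%N|exists (b 0%N) => _ [n _ <-]].
exists (sup (range a)) => n.
have h3 : a n <= sup (range a) by apply: sup_upper_bound => //; exists n.
have h4 : sup (range a) <= b n by apply: ge_sup => [|_ [m _ <-]//]; exists (a 0%N), 0%N.
by move: h3 h4; rewrite /a /b ler_norml => ? ?; apply/andP; split; lra.
Qed.

(** Tailored to one mode: with [a] its starting time and [b] its peak, [Q1] bounds the gain and
    viscous part, active from [a], and [Q2] the loss, active only from [b]. [F] is estimated from
    [b] in both directions and is constant before [a]. *)
Lemma primitive_norm_le (R : realType) (F h : R -> R) (a b T Q1 Q2 : R) :
  a <= b -> b <= T -> 0 <= Q1 -> 0 <= Q2 ->
  (forall t : R, is_derive t 1 F (h t)) -> F b = 0 ->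
  (forall t, t <= a -> h t = 0) -> (forall t, t <= b -> `|h t| <= Q1) ->
  (forall t, `|h t| <= Q1 + Q2) ->
  forall t, t <= T -> `|F t| <= (T - a) * Q1 + (T - b) * Q2.
Proof.
move=> ab bT Q1_ge0 Q2_ge0 Fh Fb ha hb hQ t tT.
have [bt|tb] := leP b t.
  have := norm_increment_le bt (fun x _ => Fh x) (fun x _ => hQ x).
  rewrite Fb subr0 => /le_trans; apply.
  apply: (@le_trans _ _ ((Q1 + Q2) * (T - b))).
    by rewrite ler_wpM2l ?addr_ge0// lerD2r.
  rewrite mulrDl; apply: lerD; rewrite mulrC// ler_wpM2r//; lra.
suff : `|F t| <= (b - a) * Q1.
  move=> /le_trans; apply; apply: (@le_trans _ _ ((T - a) * Q1)).
    by rewrite ler_wpM2r// lerD2r.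
  by rewrite lerDl mulr_ge0// subr_ge0.
have bnd x : x <= b -> `|F x| <= Q1 * (b - x).
  move=> xb; have := norm_increment_le xb (fun x _ => Fh x).
  move=> /(_ Q1); rewrite Fb sub0r normrN; apply => y /andP[_ yb]; exact: hb.
have [at_|ta] := leP a t.
  apply: (le_trans (bnd _ (ltW tb))); rewrite mulrC ler_wpM2r//; lra.
suff -> : F t = F a by rewrite mulrC bnd.
have := norm_increment_le (ltW ta) (fun x _ => Fh x) (Q := 0).
rewrite mul0r => h0; have /eqP : `|F a - F t| == 0.
  rewrite eq_le normr_ge0 andbT; apply: h0 => x /andP[_ xa].
  by rewrite ha// normr0.
by move/normr0_eq0/subr0_eq.
Qed.

(** Freezing the exponential above 1 makes it bounded and globally Lipschitz, as the contraction
    argument requires. *)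
Definition expcap (R : realType) (x : R) : R := expR (Num.min x 1).

Section expcap.
Context {R : realType}.
Implicit Types x y : R.

Lemma expcap_gt0 x : 0 < expcap x.
Proof. exact: expR_gt0. Qed.

Lemma expcap_le x : expcap x <= expR 1.
Proof. by rewrite ler_expR ge_min lexx orbT. Qed.

Lemma expcapE x : x <= 1 -> expcap x = expR x.
Proof. by move=> x1; rewrite /expcap min_l. Qed.

Lemma expcap_ge x y : x <= 1 -> x <= y -> expR x <= expcap y.
Proof. by move=> x1 xy; rewrite ler_expR le_min xy. Qed.

Lemma expcap_lip x y : `|expcap x - expcap y| <= expR 1 * `|x - y|.
Proof.
wlog yx : x y / y <= x.
  move=> h; have [|/ltW yx] := leP y x; first exact: h.
  by rewrite distrC (distrC x); exact: h.
have hm : Num.min y 1 <= Num.min x 1.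
  by rewrite le_min !ge_min yx lexx orbT.
rewrite !ger0_norm ?subr_ge0// ?ler_expR//.
have hd : Num.min x 1 - Num.min y 1 <= x - y.
  by rewrite /Num.min; case: (ltP x 1) => ?; case: (ltP y 1) => ?; lra.
have := expR_ge1Dx (Num.min y 1 - Num.min x 1); set d := _ - Num.min x 1 => hexp.
have -> : expcap y = expcap x * expR d.
  by rewrite /expcap -expRD /d; congr expR; ring.
have := expcap_le x; have := expcap_gt0 x; move: (expcap x) => E E0 Ee.
apply: (@le_trans _ _ (E * (x - y))).
  have -> : E - E * expR d = E * (1 - expR d) by ring.
  rewrite ler_wpM2l// ?(ltW E0)//; move: hd hexp; rewrite /d; lra.
by rewrite ler_wpM2r// subr_ge0.
Qed.

Lemma continuous_expcap : continuous (@expcap R).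
Proof.
move=> x; apply: continuous_comp; last exact: continuous_expR.
by apply: continuous_min => //; exact: cvg_cst.
Qed.

End expcap.

(** * The cascade as a fixed point *)

Section fixed_point.
Context {R : realType}.
Variables (T : R) (tm r v p M : nat -> R) (chi : nat -> R -> R) (C : R).
Local Notation e := (expR (1 : R)).
Hypotheses (tm_ge0 : forall k, 0 <= tm k)
  (tm_ltS : forall k, tm k < tm k.+1) (tm_ltT : forall k, tm k < T)
  (chi_cont : forall k, continuous (chi k))
  (chi_ge0 : forall k t, 0 <= chi k t) (chi_le1 : forall k t, chi k t <= 1)
  (chi_eq0 : forall k t, t <= tm k -> chi k t = 0)
  (r_ge0 : forall k, 0 <= r k) (v_ge0 : forall k, 0 <= v k)
  (p_ge0 : forall k, 0 <= p k) (M_gt0 : forall k, 0 < M k)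
  (gain : forall k, 4 * ((T - tm k) * (r k * e * M k.-1)) <= M k)
  (loss : forall k,
    4 * ((T - tm k.+1) * (p k * e ^+ 3 * (2 * M k.+1 + M k))) <= M k)
  (first_step : forall k, (T - tm k) * (r k * e + v k) +
     (T - tm k.+1) * (p k * e ^+ 3) <= C * M k).

(** Logarithmic derivative of mode [k]: the gain [r] from mode [k-1] and the viscous rate [v],
    switched on from [tm k], then the loss [p] to mode [k+1], switched on from [tm k.+1], the peak
    time of mode [k]. At [k = 0] the index [k.-1] is 0 by default, harmless because the application
    has [r 0 = 0]. *)
Definition cascade_rate (z : nat -> R -> R) (k : nat) (t : R) : R :=
  chi k t * (r k * expcap (z k.-1 t) - v k)
  - chi k.+1 t * (p k * (expcap (z k.+1 t) ^+ 2 * expcap (- z k t))).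

(** Integration starts at the peak time, where [z k = 0] is the normalisation, and the result is
    frozen after [T], so that the bounds hold at every real time. *)
Let picard_step (z z' : nat -> R -> R) :=
  forall k, exists F : R -> R,
    [/\ forall t : R, is_derive t 1 F (cascade_rate z k t), F (tm k.+1) = 0 &
        forall t, z' k t = F (Num.min t T)].

Let clamp_cont : continuous (fun t : R => Num.min t T).
Proof. by move=> t; apply: continuous_min => //; exact: cvg_cst. Qed.

Let step_cont z z' : picard_step z z' -> forall k, continuous (z' k).
Proof.
move=> zz' k; have [F [Fd _ z'E]] := zz' k.
have -> : z' k = F \o (fun t => Num.min t T) by apply/funext => t; rewrite z'E.
move=> t; apply: continuous_comp; first exact: clamp_cont.
exact: is_derive_continuous (Fd _).
Qed.

Let rate_cont (z : nat -> R -> R) k : (forall j, continuous (z j)) -> continuous (cascade_rate z k).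
Proof.
move=> zc t.
have Ec (g : R -> R) : {for t, continuous g} ->
    (expcap (g x) @[x --> t] --> expcap (g t)).
  by move=> gc; apply: continuous_comp gc _; exact: continuous_expcap.
apply: cvgB.
  apply: cvgM; first exact: chi_cont.
  apply: cvgB; last exact: cvg_cst.
  by apply: cvgM; [exact: cvg_cst|exact/Ec/zc].
apply: cvgM; first exact: chi_cont.
apply: cvgM; first exact: cvg_cst.
apply: cvgM; last by apply/Ec; apply: cvgN; exact: zc.
by rewrite expr2; under eq_fun do rewrite expr2; apply: cvgM; exact/Ec/zc.
Qed.

Let step_exists (z : nat -> R -> R) : (forall j, continuous (z j)) -> exists z', picard_step z z'.
Proof.
move=> zc.
have /choice[F FP] : forall k, exists F : R -> R,
    (forall t : R, is_derive t 1 F (cascade_rate z k t)) /\ F (tm k.+1) = 0.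
  move=> k; have [|F Fd] := primitive_exists (@rate_cont z k zc).
    move=> t t0; rewrite /cascade_rate !chi_eq0 ?mul0r ?subrr//.
      exact: le_trans (tm_ge0 _).
    exact: le_trans (tm_ge0 _).
  exists (fun t => F t - F (tm k.+1)); split; last by rewrite subrr.
  by move=> t; apply: is_derive_eq; rewrite subr0.
exists (fun k t => F k (Num.min t T)) => k; exists (F k).
by have [? ?] := FP k; split.
Qed.

Let quad_le (z : nat -> R -> R) k (t : R) :
  `|expcap (z k.+1 t) ^+ 2 * expcap (- z k t)| <= e ^+ 3.
Proof.
rewrite ger0_norm; last by rewrite mulr_ge0// ?exprn_ge0// ltW// expcap_gt0.
rewrite [leRHS]exprSr ler_pM ?exprn_ge0 ?(ltW (expcap_gt0 _)) ?expcap_le//.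
by apply: lerXn2r; rewrite ?nnegrE ?expcap_le// ?expR_ge0// ltW// expcap_gt0.
Qed.

Let quad_lip (a a' b b' : R) :
  `|expcap a ^+ 2 * expcap b - expcap a' ^+ 2 * expcap b'| <=
  e ^+ 3 * (2 * `|a - a'| + `|b - b'|).
Proof.
move: (expcap_gt0 a) (expcap_le a) (expcap_gt0 a') (expcap_le a').
move: (expcap_gt0 b) (expcap_le b) (expcap_gt0 b') (expcap_le b').
move: (expcap_lip a a') (expcap_lip b b').
move: (expcap a) (expcap b) (expcap a') (expcap b') => x y x' y'.
move=> xx' yy' b0 b1 b'0 b'1 a0 a1 a'0 a'1.
have -> : x ^+ 2 * y - x' ^+ 2 * y' =
  (x - x') * ((x + x') * y) + x' ^+ 2 * (y - y') by ring.
apply: (le_trans (ler_normD _ _)).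
have -> : e ^+ 3 * (2 * `|a - a'| + `|b - b'|) =
  e * `|a - a'| * ((e + e) * e) + e ^+ 2 * (e * `|b - b'|) by ring.
apply: lerD; rewrite normrM.
  rewrite ler_pM// normrM ler_pM//; last by rewrite ger0_norm// ltW.
  by rewrite ger0_norm ?addr_ge0 ?(ltW a0) ?(ltW a'0)// lerD.
rewrite ler_pM//.
by rewrite normrX ger0_norm ?(ltW a'0)// lerXn2r ?nnegrE ?expR_ge0 ?(ltW a'0).
Qed.

Let chi_mul_le k t (x : R) : `|chi k t * x| <= `|x|.
Proof.
by rewrite normrM ger0_norm// ler_piMl.
Qed.

(** The caps bound the rate whatever [z] is; for the image of 0 this controls the first Picard
    increment. *)
Let step_init z z' : picard_step z z' -> forall k t, `|z' k t| <= C * M k.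
Proof.
move=> zz' k t; have [F [Fd Fb z'E]] := zz' k; rewrite z'E.
have b1 s : `|chi k s * (r k * expcap (z k.-1 s) - v k)| <= r k * e + v k.
  apply: (le_trans (chi_mul_le _ _ _)).
  rewrite (le_trans (ler_normB _ _))// lerD//; last by rewrite ger0_norm.
  rewrite normrM !ger0_norm ?(ltW (expcap_gt0 _))// ler_wpM2l// expcap_le.
  by [].
have b2 s : `|chi k.+1 s * (p k * (expcap (z k.+1 s) ^+ 2 * expcap (- z k s)))|
    <= p k * e ^+ 3.
  apply: (le_trans (chi_mul_le _ _ _)).
  by rewrite normrM ger0_norm// ler_wpM2l// quad_le.
apply: le_trans (first_step k).
apply: (primitive_norm_le _ _ _ _ Fd Fb).
- exact: ltW.
- exact: ltW.
- by rewrite addr_ge0// mulr_ge0// expR_ge0.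
- by rewrite mulr_ge0// exprn_ge0// expR_ge0.
- move=> s sk; rewrite /cascade_rate !chi_eq0 ?mul0r ?subrr//.
  exact: (le_trans sk (ltW _)).
- move=> s sk; rewrite /cascade_rate [chi k.+1 s]chi_eq0// mul0r subr0.
  exact: b1.
- by move=> s; rewrite /cascade_rate (le_trans (ler_normB _ _))// lerD.
- by rewrite ge_min lexx orbT.
Qed.

(** The rates differ by at most [Q1] through the gain and by a further [Q2] through the loss.
    Multiplied by the time left to [T], each contribution is at most [D * M k / 4], by [gain] and
    [loss]. *)
Let step_contract z1 z2 z1' z2' D : picard_step z1 z1' -> picard_step z2 z2' ->
  (forall k t, `|z1 k t - z2 k t| <= D * M k) ->
  forall k t, `|z1' k t - z2' k t| <= D / 2 * M k.
Proof.
move=> s1 s2 dz k t; have [F1 [F1d F1b z1E]] := s1 k.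
have [F2 [F2d F2b z2E]] := s2 k; rewrite z1E z2E.
have D0 : 0 <= D.
  have := le_trans (normr_ge0 _) (dz k 0); rewrite pmulr_lge0//.
pose Q1 := r k * (e * (D * M k.-1)).
pose Q2 := p k * (e ^+ 3 * (2 * (D * M k.+1) + D * M k)).
have Q1_ge0 : 0 <= Q1 by rewrite !mulr_ge0// ?expR_ge0// ltW.
have Q2_ge0 : 0 <= Q2.
  by rewrite !mulr_ge0// ?exprn_ge0 ?expR_ge0// addr_ge0// !mulr_ge0// ltW.
have b1 s : `|chi k s * (r k * expcap (z1 k.-1 s) - v k)
           - chi k s * (r k * expcap (z2 k.-1 s) - v k)| <= Q1.
  rewrite -mulrBr; apply: (le_trans (chi_mul_le _ _ _)).
  have -> (x y : R) : r k * x - v k - (r k * y - v k) = r k * (x - y) by ring.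
  rewrite normrM ger0_norm// ler_wpM2l//.
  by apply: (le_trans (expcap_lip _ _)); rewrite ler_wpM2l// expR_ge0.
have b2 s :
   `|chi k.+1 s * (p k * (expcap (z1 k.+1 s) ^+ 2 * expcap (- z1 k s)))
    - chi k.+1 s * (p k * (expcap (z2 k.+1 s) ^+ 2 * expcap (- z2 k s)))| <= Q2.
  rewrite -!mulrBr; apply: (le_trans (chi_mul_le _ _ _)).
  rewrite normrM ger0_norm// ler_wpM2l//.
  apply: (le_trans (quad_lip _ _ _ _)).
  rewrite ler_wpM2l ?exprn_ge0 ?expR_ge0// lerD ?ler_wpM2l//.
  by rewrite -opprD normrN.
have Fd (s : R) : is_derive s 1 (F1 - F2) (cascade_rate z1 k s - cascade_rate z2 k s).
  exact: is_deriveB.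
have Fb : (F1 - F2) (tm k.+1) = 0 by rewrite !fctE F1b F2b subrr.
set s := Num.min t T.
have sT : s <= T by rewrite ge_min lexx orbT.
have -> : F1 s - F2 s = (F1 - F2) s by [].
have rE z y : y <= tm k.+1 ->
    cascade_rate z k y = chi k y * (r k * expcap (z k.-1 y) - v k).
  by move=> yk; rewrite /cascade_rate [chi k.+1 y]chi_eq0// mul0r subr0.
apply: (@le_trans _ _ ((T - tm k) * Q1 + (T - tm k.+1) * Q2)); last first.
  rewrite /Q1 /Q2.
  have := ler_wpM2l D0 (gain k); have := ler_wpM2l D0 (loss k).
  set a := T - tm k; set b := T - tm k.+1; move=> h1 h2.
  have -> : a * (r k * (e * (D * M k.-1))) = D * (a * (r k * e * M k.-1)) by ring.
  have -> : b * (p k * (e ^+ 3 * (2 * (D * M k.+1) + D * M k))) =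
  D * (b * (p k * e ^+ 3 * (2 * M k.+1 + M k))) by ring.
  move: h1 h2; rewrite !(mulrCA D 4); lra.
apply: (primitive_norm_le (ltW (tm_ltS k)) (ltW (tm_ltT k.+1))
  Q1_ge0 Q2_ge0 Fd Fb _ _ _ sT).
- move=> y yk; rewrite !rE ?chi_eq0 ?mul0r ?subrr//.
    exact: (le_trans yk (ltW _)).
  exact: (le_trans yk (ltW _)).
- by move=> y yk; rewrite !rE.
- move=> y; rewrite /cascade_rate opprD opprK addrACA.
  rewrite (le_trans (ler_normD _ _))// lerD//.
  by rewrite addrC distrC.
Qed.

Lemma cascade_exists : exists z : nat -> R -> R,
  (forall k, continuous (z k)) /\
  forall k, exists F : R -> R,
    [/\ forall t : R, is_derive t 1 F (cascade_rate z k t), F (tm k.+1) = 0 &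
        forall t, z k t = F (Num.min t T)].
Proof.
(* Bundling continuity with the family lets a chosen image be iterated. *)
have /choice[step stepP] : forall z : {z : nat -> R -> R | forall j, continuous (z j)},
    exists z' : {z : nat -> R -> R | forall j, continuous (z j)},
      picard_step (sval z) (sval z').
  move=> [z zc]; have [z' zz'] := step_exists zc.
  by exists (exist _ z' (step_cont zz')).
have c0 (j : nat) : continuous (fun _ : R => 0 : R) by move=> t; exact: cvg_cst.
pose z0 : {z : nat -> R -> R | forall j, continuous (z j)} :=
  exist _ (fun _ _ => 0) c0.
pose zs n := sval (iter n step z0).
have zsc n : forall j, continuous (zs n j) by exact: (svalP (iter n step z0)).
have zsS n : picard_step (zs n) (zs n.+1) by rewrite /zs iterS; exact: stepP.
have zsd n k t : `|zs n.+1 k t - zs n k t| <= C / 2 ^+ n * M k.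
  elim: n k t => [|n IH] k t.
    by rewrite expr0 divr1 /zs/= subr0; exact: (step_init (zsS 0%N)).
  have := step_contract (zsS n.+1) (zsS n) IH k t.
  by rewrite exprSr invfM -!mulrA (mulrCA _ 2^-1).
have /choice[z zP] : forall k, exists zk : R -> R, forall t n,
    `|zs n k t - zk t| <= 2 * (C * M k) / 2 ^+ n.
  move=> k; suff /choice[zk zkP] : forall t, exists l, forall n,
    `|zs n k t - l| <= 2 * (C * M k) / 2 ^+ n by exists zk.
  move=> t; apply: (geometric_limit (u := fun n => zs n k t)) => n.
  by rewrite mulrAC; exact: zsd.
have small (k : nat) (eps : R) : 0 < eps ->
    exists n, 2 * (C * M k) / 2 ^+ n <= eps.
  move=> eps0.
  have : (2 * (C * M k)) * (2^-1) ^+ n @[n --> \oo] --> 2 * (C * M k) * 0.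
    by apply: cvgM; [exact: cvg_cst|apply: cvg_expr; rewrite ger0_norm; lra].
  rewrite mulr0 => /cvgrPdist_le /(_ _ eps0)[N _ /(_ N (leqnn _))].
  rewrite sub0r normrN => h; exists N; rewrite (le_trans _ h)// -exprVn.
  exact: ler_norm.
have zc k : continuous (z k).
  move=> t; apply/cvgrPdist_le => eps eps0.
  have [n nP] := small k (eps / 3) (divr_gt0 eps0 (ltr0n _ 3)).
  have := zsc n k t => /cvgrPdist_le /(_ (eps / 3) (divr_gt0 eps0 (ltr0n _ 3))).
  apply: filterS => s ds.
  have h1 := le_trans (zP k t n) nP; have h2 := le_trans (zP k s n) nP.
  move: ds h1 h2; rewrite !ler_norml => /andP[? ?] /andP[? ?] /andP[? ?].
  by apply/andP; split; lra.
exists z; split => //.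
(* The image [z'] of the limit is close to [zs n.+1] by contraction, and [zs n.+1] is close to [z],
   so letting [n] grow gives [z' = z]. *)
have [z' zz'] := step_exists zc.
suff zE : z' = z by move: zz'; rewrite zE.
apply/funext => k; apply/funext => t; apply/subr0_eq/eqP.
rewrite -normr_le0; apply/ler_addgt0Pr => eps eps0; rewrite add0r.
have [n nP] := small k eps eps0; apply: le_trans nP.
have h1 j s : `|z j s - zs n j s| <= 2 * C / 2 ^+ n * M j.
  rewrite distrC (le_trans (zP j s n))//.
  by rewrite le_eqVlt; apply/orP; left; apply/eqP; ring.
have h2 := step_contract zz' (zsS n) h1 k t.
have h3 := zP k t n.+1.
rewrite -(subrKA (zs n.+1 k t)) (le_trans (ler_normD _ _))//.
rewrite (le_trans (lerD h2 h3))// le_eqVlt; apply/orP; left; apply/eqP.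
by rewrite exprS; field; rewrite expf_neq0.
Qed.

End fixed_point.

(** * Shape of the fixed point: the caps are inactive *)

Section profile.
Context {R : realType}.
Variables (T : R) (tm mid r v p : nat -> R) (chi : nat -> R -> R).
Variable z : nat -> R -> R.
Local Notation e := (expR (1 : R)).
Hypotheses (tm_ge0 : forall k, 0 <= tm k)
  (tm_ltS : forall k, tm k < tm k.+1) (tm_ltT : forall k, tm k < T)
  (tm_mid : forall k, tm k <= mid k) (mid_tm : forall k, mid k <= tm k.+1)
  (chi_ge0 : forall k t, 0 <= chi k t) (chi_le1 : forall k t, chi k t <= 1)
  (chi_eq0 : forall k t, t <= tm k -> chi k t = 0)
  (chi_eq1 : forall k t, mid k <= t -> chi k t = 1)
  (r0 : r 0%N = 0) (r_ge0 : forall k, 0 <= r k) (v_ge0 : forall k, 0 <= v k)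
  (p_ge0 : forall k, 0 <= p k)
  (late : forall k, (T - tm k.+1) * (r k * e + v k + p k * e ^+ 3) <= 1)
  (v0_le : tm 1%N * v 0%N <= 1)
  (gain_loss : forall k, 2 * v k.+1 <= r k.+1 / e)
  (zP : forall k, exists F : R -> R,
    [/\ forall t : R, is_derive t 1 F (cascade_rate r v p chi z k t),
        F (tm k.+1) = 0 & forall t, z k t = F (Num.min t T)]).

Let rate_le k t :
  `|cascade_rate r v p chi z k t| <= r k * e + v k + p k * e ^+ 3.
Proof.
have e0 : 0 <= e := expR_ge0 _.
have chiM j x : `|chi j t * x| <= `|x| by rewrite normrM ger0_norm// ler_piMl.
rewrite /cascade_rate (le_trans (ler_normB _ _))// lerD//.
  apply: (le_trans (chiM _ _)); rewrite (le_trans (ler_normB _ _))// lerD//.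
    rewrite normrM !ger0_norm ?(ltW (expcap_gt0 _))// ler_wpM2l// expcap_le//.
  by rewrite ger0_norm.
apply: (le_trans (chiM _ _)); rewrite normrM ger0_norm// ler_wpM2l//.
rewrite ger0_norm; last by rewrite mulr_ge0// ?exprn_ge0// ltW// expcap_gt0.
rewrite [leRHS]exprSr ler_pM ?exprn_ge0 ?(ltW (expcap_gt0 _)) ?expcap_le//.
by apply: lerXn2r; rewrite ?nnegrE ?expcap_le// ltW// expcap_gt0.
Qed.

Let rateE k t : t <= tm k.+1 ->
  cascade_rate r v p chi z k t = chi k t * (r k * expcap (z k.-1 t) - v k).
Proof. by move=> tk; rewrite /cascade_rate [chi k.+1 t]chi_eq0// mul0r subr0. Qed.

(** The profile vanishes at the peak and, by [late], the time left to [T] is too short for it to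
    move by more than 1. *)
Lemma profile_late k t : tm k.+1 <= t -> -1 <= z k t <= 1.
Proof.
move=> kt; have [F [Fd Fb ->]] := zP k; set s := Num.min t T.
have ks : tm k.+1 <= s by rewrite le_min kt ltW.
rewrite -ler_norml.
have := norm_increment_le ks (fun x _ => Fd x) (fun x _ => rate_le k x).
rewrite Fb subr0 => /le_trans; apply; apply: le_trans (late k).
rewrite mulrC ler_wpM2r ?lerD2r ?ge_min ?lexx ?orbT//.
by rewrite !addr_ge0 ?mulr_ge0 ?exprn_ge0 ?expR_ge0.
Qed.

Let half_gain k : r k.+1 / (2 * e) <= r k.+1 / e - v k.+1.
Proof. by have := gain_loss k; rewrite invfM mulrCA; set x := r k.+1 / e; lra. Qed.

(** While mode [k+1] grows, mode [k] is past its peak, so its exponential is at least [expR (-1)];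
    viscosity takes at most half of the resulting gain. *)
Let rate_ge k t : tm k.+1 <= t -> t <= tm k.+2 ->
  chi k.+1 t * (r k.+1 / (2 * e)) <= cascade_rate r v p chi z k.+1 t.
Proof.
move=> kt tk; rewrite rateE// ler_wpM2l// (le_trans (half_gain k))// lerD2r.
rewrite ler_wpM2l//= -expRN; apply: expcap_ge; first by lra.
by have /andP[] := profile_late kt.
Qed.

Let rate_ge0 k t : t <= tm k.+2 -> 0 <= cascade_rate r v p chi z k.+1 t.
Proof.
move=> tk; have [kt|tk1] := leP (tm k.+1) t.
  apply: le_trans (rate_ge kt tk).
  by rewrite !mulr_ge0// invr_ge0 mulr_ge0// expR_ge0.
by rewrite rateE// chi_eq0 ?mul0r// ltW.
Qed.

(** Between [mid k.+1] and the peak, where it is 0, the profile rises at rate at least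
    [r k.+1 / (2 * e)]; before that it is nondecreasing. This makes the mode exponentially small as
    long as its cut-off is not fully on. *)
Lemma profile_early k t : t <= mid k.+1 ->
  z k.+1 t <= - ((tm k.+2 - mid k.+1) * (r k.+1 / (2 * e))).
Proof.
move=> tk; have [F [Fd Fb ->]] := zP k.+1; set s := Num.min t T.
have sk : s <= mid k.+1 by rewrite ge_min tk.
have [c /andP[_ ck]] := mean_value sk (fun x _ => Fd x).
have [d /andP[kd dk]] := mean_value (mid_tm k.+1) (fun x _ => Fd x).
rewrite Fb sub0r => h1 h2.
have g1 : 0 <= F (mid k.+1) - F s.
  by rewrite h2; apply: mulr_ge0; [exact/rate_ge0/(le_trans ck)|rewrite subr_ge0].
have g2 : (tm k.+2 - mid k.+1) * (r k.+1 / (2 * e)) <= - F (mid k.+1).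
  rewrite h1 mulrC ler_wpM2r ?subr_ge0//.
  have := rate_ge (le_trans (tm_mid _) kd) dk; rewrite chi_eq1// mul1r//.
lra.
Qed.

(** After the peak this is [profile_late]. Before it, a mode [k+1] rises to 0, hence is nonpositive;
    mode 0 has no gain and only decays by viscosity, in total at most [tm 1%N * v 0%N]. *)
Lemma profile_le1 k t : z k t <= 1.
Proof.
have [kt|/ltW tk] := leP (tm k.+1) t; first by have /andP[] := profile_late kt.
have [F [Fd Fb ->]] := zP k; set s := Num.min t T.
have sk : s <= tm k.+1 by rewrite ge_min tk.
case: k tk Fd Fb sk => [|k] tk Fd Fb sk.
  have e0 : 0 <= e := expR_ge0 _.
  (* With [tm 1] as final time, the loss bound gets weight 0. *)
  have := primitive_norm_le (ltW (tm_ltS 0)) (lexx _) (v_ge0 0)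
    (_ : 0 <= r 0%N * e + p 0%N * e ^+ 3) Fd Fb _ _ _ sk.
  rewrite subrr mul0r addr0 => h.
  apply: (le_trans (ler_norm _)); apply: le_trans v0_le.
  apply: (@le_trans _ _ ((tm 1%N - tm 0%N) * v 0%N)).
    apply: h.
    - by rewrite addr_ge0// mulr_ge0// exprn_ge0.
    - by move=> y y0; rewrite rateE ?chi_eq0 ?mul0r// (le_trans y0)// ltW.
    - move=> y y1; rewrite rateE// r0 mul0r sub0r mulrN normrN normrM.
      by rewrite !ger0_norm// ler_piMl.
    - by move=> y; rewrite (le_trans (rate_le 0 y))//; lra.
  by rewrite ler_wpM2r// gerBl.
have [c /andP[_ ck]] := mean_value sk (fun x _ => Fd x).
rewrite Fb sub0r => h; have : 0 <= - F s.
  by rewrite h; apply: mulr_ge0; [exact/rate_ge0/(le_trans ck)|rewrite subr_ge0].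
lra.
Qed.

(** The cap on [- z k] matters only where [chi k.+1] is nonzero, which is after the peak of mode
    [k], and there [z k] is at least -1. *)
Lemma profile_derive k (t : R) : t < T ->
  is_derive t 1 (z k) (chi k t * (r k * expR (z k.-1 t) - v k) -
    chi k.+1 t * (p k * (expR (z k.+1 t) ^+ 2 * expR (- z k t)))).
Proof.
move=> tT; have [F [Fd _ zE]] := zP k.
apply: (@near_eq_is_derive _ _ _ F).
  by near=> s; rewrite zE min_l//; apply: ltW; near: s; exact: lt_nbhsl.
apply: is_derive_eq; rewrite /cascade_rate !(expcapE (profile_le1 _ _)).
have [tk|kt] := leP t (tm k.+1); first by rewrite [chi k.+1 t]chi_eq0 ?mul0r.
by rewrite expcapE// lerNl; have /andP[] := profile_late (ltW kt).
Unshelve. all: by end_near. Qed.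

Lemma profile_peak k : z k (tm k.+1) = 0.
Proof. by have [F [_ Fb ->]] := zP k; rewrite min_l// ltW. Qed.

End profile.

(** * Classes of smooth families of functions *)

Section symbol_class.
Context {R : realType}.
Implicit Types (B : (nat -> R -> R) -> Prop) (u v : nat -> R -> R).

(** A symbol class: in the applications [B] restricts the size of the family in terms of the mode
    index, uniformly in time on [U], and it is imposed on all time derivatives up to order [n]. *)
Fixpoint smooth_class (U : set R) B (n : nat) u : Prop :=
  if n is m.+1 then
    [/\ B u, forall k t, U t -> derivable (u k) t 1 &
        smooth_class U B m (fun k => derive1 (u k))]
  else B u.

Definition additive_class (U : set R) B :=
  [/\ forall u v, (forall k t, U t -> u k t = v k t) -> B u -> B v,
      B (fun _ _ => 0) &
      forall u v, B u -> B v -> B (fun k t => u k t + v k t)].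

Lemma smooth_class_bound U B n u : smooth_class U B n u -> B u.
Proof. by case: n => // n []. Qed.

Lemma smooth_classW U B n u : smooth_class U B n.+1 u -> smooth_class U B n u.
Proof.
by elim: n u => [|n IH] u; [case|move=> [Bu du /IH dS]; split].
Qed.

Lemma smooth_class_derive1n U B n m u : smooth_class U B (n + m) u ->
  smooth_class U B m (fun k => derive1n n (u k)).
Proof.
elim: n u => [|n IH] u // [_ _ /IH].
by under [X in _ -> smooth_class _ _ _ X]eq_fun do rewrite derive1Sn.
Qed.

Section on_open_set.
Variables (U : set R) (B : (nat -> R -> R) -> Prop).
Hypotheses (oU : open U) (BU : additive_class U B).

Let near_eq u v k (t : R) : (forall k t, U t -> u k t = v k t) -> U t ->
  \forall s \near t, u k s = v k s.
Proof.
by move=> uv Ut; near=> s; apply: uv; near: s; exact: open_nbhs_nbhs.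
Unshelve. all: by end_near. Qed.

Lemma smooth_class_ext n u v : (forall k t, U t -> u k t = v k t) ->
  smooth_class U B n u -> smooth_class U B n v.
Proof.
have [Be _ _] := BU; elim: n u v => [|n IH] u v uv; first exact: Be.
move=> [Bu du Su]; split; first exact: Be Bu.
  by move=> k t Ut; apply: (near_eq_derivable (near_eq k uv Ut)); exact: du.
apply: IH Su => k t Ut; rewrite !derive1E.
exact: near_eq_derive (near_eq k uv Ut).
Qed.

Lemma smooth_classS n u v : B u ->
  (forall k (t : R), U t -> is_derive t 1 (u k) (v k t)) ->
  smooth_class U B n v -> smooth_class U B n.+1 u.
Proof.
move=> Bu uv Sv; split => // [k t Ut|]; first by have [] := uv k t Ut.
by apply: smooth_class_ext Sv => k t /(uv k)[_ <-]; rewrite derive1E.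
Qed.

Lemma smooth_class_is_derive n u k (t : R) : smooth_class U B n.+1 u -> U t ->
  is_derive t 1 (u k) (derive1 (u k) t).
Proof. by move=> [_ du _] Ut; rewrite derive1E; exact/derivableP/du. Qed.

Lemma smooth_class0 n : smooth_class U B n (fun _ _ => 0).
Proof.
have [_ B0 _] := BU; elim: n => // n; exact: smooth_classS.
Qed.

Lemma smooth_class_add n u v : smooth_class U B n u -> smooth_class U B n v ->
  smooth_class U B n (fun k t => u k t + v k t).
Proof.
have [_ _ Badd] := BU; elim: n u v => [|n IH] u v; first exact: Badd.
move=> Su Sv; have [Bu _ Su'] := Su; have [Bv _ Sv'] := Sv.
apply: (smooth_classS _ _ (IH _ _ Su' Sv')); first exact: Badd.
move=> k t Ut; have := smooth_class_is_derive k Su Ut.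
have := smooth_class_is_derive k Sv Ut.
by move=> ? ?; exact: is_deriveD.
Qed.

Lemma smooth_class_mul B1 B2 n u v :
  (forall u v, B1 u -> B2 v -> B (fun k t => u k t * v k t)) ->
  smooth_class U B1 n u -> smooth_class U B2 n v ->
  smooth_class U B n (fun k t => u k t * v k t).
Proof.
move=> B12; elim: n u v => [|n IH] u v; first exact: B12.
move=> Su Sv; have [Bu du Su'] := Su; have [Bv dv Sv'] := Sv.
have SW1 := smooth_classW Su; have SW2 := smooth_classW Sv.
apply: (smooth_classS _ _ (smooth_class_add (IH _ _ SW1 Sv') (IH _ _ Su' SW2))).
  exact: B12.
move=> k t Ut.
have h1 : is_derive t 1 (u k) (derive1 (u k) t).
  by rewrite derive1E; exact/derivableP/du.
have h2 : is_derive t 1 (v k) (derive1 (v k) t).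
  by rewrite derive1E; exact/derivableP/dv.
have h : is_derive t 1 (u k * v k) _ := is_deriveM h1 h2.
by apply: is_derive_eq; rewrite /GRing.scale/= (mulrC (v k t)).
Qed.

Lemma smooth_class_reindex n u (phi : nat -> nat) :
  (forall u, B u -> B (fun k => u (phi k))) ->
  smooth_class U B n u -> smooth_class U B n (fun k => u (phi k)).
Proof.
move=> Bphi; elim: n u => [|n IH] u; first exact: Bphi.
by move=> [Bu du Su]; split => [|k t|]; [exact: Bphi|exact: du|exact: IH Su].
Qed.

Lemma smooth_class_cst n (c : nat -> R) : B (fun k _ => c k) ->
  smooth_class U B n (fun k _ => c k).
Proof.
by case: n => // n Bc; exact: (smooth_classS _ _ (smooth_class0 n)).
Qed.

End on_open_set.

(** Each single mode already vanishes between [c k] and [T], so its extension by 0 is smooth across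
    [T] even if the [c k] accumulate there; the size bounds are those below [T]. *)
Lemma smooth_class_extend (T : R) (c : nat -> R) B BT n u :
  additive_class setT BT ->
  (forall u, B u -> BT (fun k t => if t < T then u k t else 0)) ->
  (forall k, c k < T) -> (forall k t, c k < t -> t < T -> u k t = 0) ->
  smooth_class [set t | t < T] B n u ->
  smooth_class setT BT n (fun k t => if t < T then u k t else 0).
Proof.
move=> BTP ext cT; elim: n u => [|n IH] u u0; first exact: ext.
move=> [Bu du Su].
have loc0 k (t : R) : c k < t -> \forall s \near t, 0 = if s < T then u k s else 0.
  move=> kt; near=> s; case: ifPn => // sT; rewrite u0//.
  by near: s; exact: lt_nbhsr.
have u'0 k t : c k < t -> t < T -> derive1 (u k) t = 0.
  move=> kt tT; rewrite derive1E -(@near_eq_derive _ _ _ (fun=> 0)) ?derive_cst//.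
  near=> s; rewrite u0//; first by near: s; exact: lt_nbhsr.
  by near: s; exact: lt_nbhsl.
apply: (smooth_classS _ _ _ _ (IH _ u'0 Su)) => //.
- exact: openT.
- exact: ext.
move=> k t _; case: ifPn => [tT|]; last rewrite -leNgt => Tt.
  apply: (@near_eq_is_derive _ _ _ (u k)).
    by near=> s; rewrite ifT//; near: s; exact: lt_nbhsl.
  by rewrite derive1E; exact/derivableP/du.
by apply: (near_eq_is_derive (loc0 k t _)); exact: lt_le_trans (cT k) Tt.
Unshelve. all: by end_near. Qed.

End symbol_class.

(** * Polynomial growth and rapid decay in the frequency *)

Section growth_classes.
Context {R : realType}.
Variables (N : R^nat) (b : R).
Implicit Types (U : set R) (u v : nat -> R -> R).

Definition poly_growth U u := exists C p : R,
  [/\ 0 <= C, 0 <= p & forall k t, U t -> `|u k t| <= C * N k `^ p].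

Definition rapid_decay U u := forall s : R, 0 <= s ->
  exists2 C : R, 0 <= C & forall k t, U t -> N k `^ s * `|u k t| <= C.

Hypotheses (N_ge1 : forall k, 1 <= N k) (b_ge0 : 0 <= b)
  (N_leS : forall k, N k <= N k.+1) (N_geS : forall k, N k.+1 <= N k `^ b).

Lemma powR_freq_ge1 k p : 0 <= p -> 1 <= N k `^ p.
Proof. by move=> p0; rewrite -(powRr0 (N k)) ler_powR. Qed.

Lemma powR_freqD k p q : N k `^ (p + q) = N k `^ p * N k `^ q.
Proof.
by rewrite powRD// [N k == 0]gt_eqF ?implybT// (lt_le_trans _ (N_ge1 k)).
Qed.

Lemma poly_growth_additive U : additive_class U (poly_growth U).
Proof.
split=> [u v uv [C [p [C0 p0 uC]]]||u v [C [p [C0 p0 uC]]] [D [q [D0 q0 vD]]]].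
- by exists C, p; split => // k t Ut; rewrite -uv// uC.
- by exists 0, 0; split => // k t _; rewrite normr0 mul0r.
exists (C + D), (p + q); split; rewrite ?addr_ge0// => k t Ut.
rewrite (le_trans (ler_normD _ _))// mulrDl lerD//.
  by rewrite (le_trans (uC _ _ Ut))// ler_wpM2l// ler_powR// lerDl.
by rewrite (le_trans (vD _ _ Ut))// ler_wpM2l// ler_powR// lerDr.
Qed.

Lemma rapid_decay_additive U : additive_class U (rapid_decay U).
Proof.
split=> [u v uv ru s s0|s s0|u v ru rv s s0].
- by have [C C0 uC] := ru s s0; exists C => // k t Ut; rewrite -uv// uC.
- by exists 0 => // k t _; rewrite normr0 mulr0.
have [C C0 uC] := ru s s0; have [D D0 vD] := rv s s0.
exists (C + D); rewrite ?addr_ge0// => k t Ut.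
apply: le_trans (lerD (uC k t Ut) (vD k t Ut)).
by rewrite -mulrDr ler_wpM2l ?powR_ge0// ler_normD.
Qed.

Lemma poly_growth_mul U u v : poly_growth U u -> poly_growth U v ->
  poly_growth U (fun k t => u k t * v k t).
Proof.
move=> [C [p [C0 p0 uC]]] [D [q [D0 q0 vD]]].
exists (C * D), (p + q); split; rewrite ?addr_ge0 ?mulr_ge0// => k t Ut.
rewrite normrM powR_freqD.
by rewrite mulrACA ler_pM ?uC ?vD.
Qed.

Lemma poly_growth_succ U u : poly_growth U u -> poly_growth U (fun k => u k.+1).
Proof.
move=> [C [p [C0 p0 uC]]]; exists C, (b * p); split; rewrite ?mulr_ge0// => k t Ut.
rewrite (le_trans (uC _ _ Ut))// ler_wpM2l// powRrM.
by apply: ge0_ler_powR; rewrite ?nnegrE ?powR_ge0// (le_trans _ (N_ge1 _)).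
Qed.

Lemma poly_growth_pred U u : poly_growth U u -> poly_growth U (fun k => u k.-1).
Proof.
move=> [C [p [C0 p0 uC]]]; exists C, p; split => // k t Ut.
rewrite (le_trans (uC _ _ Ut))// ler_wpM2l//.
apply: ge0_ler_powR => //; rewrite ?nnegrE ?(le_trans ler01 (N_ge1 _))//.
by case: k Ut => [|k] _ /=; [exact: lexx|exact: N_leS].
Qed.

Lemma rapid_decay_succ U u : rapid_decay U u -> rapid_decay U (fun k => u k.+1).
Proof.
move=> ru s s0; have [C C0 uC] := ru s s0; exists C => // k t Ut.
apply: le_trans (uC k.+1 t Ut); rewrite ler_wpM2r//.
by apply: ge0_ler_powR; rewrite ?nnegrE// ?(le_trans _ (N_ge1 _)).
Qed.

Lemma poly_growth_cst U (c : nat -> R) (C p : R) : 0 <= C -> 0 <= p ->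
  (forall k, `|c k| <= C * N k `^ p) -> poly_growth U (fun k _ => c k).
Proof. by move=> C0 p0 cC; exists C, p; split. Qed.

(** Each time derivative brings out one slope [a k], absorbed by polynomial growth. This serves for
    one fixed step function rescaled to the growth interval of each mode. *)
Lemma smooth_class_affine U n u (a c : nat -> R) : open U ->
  poly_growth U (fun k _ => a k) ->
  smooth_class setT (poly_growth setT) n u ->
  smooth_class U (poly_growth U) n (fun k t => u k (a k * t + c k)).
Proof.
move=> oU aP; have PU := @poly_growth_additive U.
elim: n u => [|n IH] u.
  by move=> [C [p [C0 p0 uC]]]; exists C, p; split => // k t _; exact: uC.
move=> Su; have [[C [p [C0 p0 uC]]] du Su'] := Su.
apply: (smooth_classS oU PU _ _ (smooth_class_mul oU PU (@poly_growth_mul U)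
  (smooth_class_cst oU PU n aP) (IH _ Su'))).
  by exists C, p; split => // k t _; exact: uC.
move=> k t Ut.
have h : is_derive t 1 (fun t => a k * t + c k) (a k).
  have h : is_derive t 1 (a k \*: @idfun R + cst (c k)) (a k *: 1 + 0).
    exact: is_deriveD.
  by apply: is_derive_eq h _; rewrite addr0 /GRing.scale/= mulr1.
have := is_derive1_comp (smooth_class_is_derive k Su (I : setT _)) h.
by rewrite mulrC.
Qed.

(* Cutting a solution of [X' = g X + h] off at times where it is still rapidly
   small and [h] vanishes: every derivative of [w X] keeps the factor [X]. *)
Lemma smooth_class_cutoff U n (X g h w : nat -> R -> R) (c : nat -> R) : open U ->
  (forall k (t : R), U t -> is_derive t 1 (X k) (g k t * X k t + h k t)) ->
  (forall m, smooth_class U (poly_growth U) m g) ->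
  (forall k t, U t -> t <= c k -> h k t = 0) ->
  (forall s, 0 <= s -> exists2 C, 0 <= C &
    forall k t, U t -> t <= c k -> N k `^ s * `|X k t| <= C) ->
  (forall m, smooth_class U (poly_growth U) m w) ->
  (forall k t, U t -> c k < t -> w k t = 0) ->
  smooth_class U (rapid_decay U) n (fun k t => w k t * X k t).
Proof.
move=> oU dX Sg h0 Xc; have PU := @poly_growth_additive U.
have RU := @rapid_decay_additive U.
elim: n w => [|n IH] w Sw w0.
  move=> s s0; have [C [p [C0 p0 wC]]] := Sw 0%N.
  have [D D0 XD] := Xc _ (addr_ge0 p0 s0).
  exists (C * D); first exact: mulr_ge0.
  move=> k t Ut; have [tc|ct] := leP t (c k); last first.
    by rewrite w0// mul0r normr0 mulr0 mulr_ge0.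
  rewrite normrM; apply: le_trans (ler_wpM2l C0 (XD k t Ut tc)).
  rewrite powR_freqD.
  by rewrite mulrCA !mulrA ler_wpM2r// ler_wpM2r ?powR_ge0// wC.
(* On [U] the product [w h] vanishes, [h] being zero up to [c k] and [w] afterwards. Hence the
   derivative of [w X] is [w' X], to which the induction, general in [w], applies. *)
pose w' k t := derive1 (w k) t + w k t * g k t.
have Sw' m : smooth_class U (poly_growth U) m w'.
  have [_ _ Sdw] := Sw m.+1.
  apply: (smooth_class_add oU PU Sdw).
  exact: (smooth_class_mul oU PU (@poly_growth_mul U) (Sw m) (Sg m)).
have w'0 k t : U t -> c k < t -> w' k t = 0.
  move=> Ut ct; rewrite /w' w0// mul0r addr0 derive1E.
  rewrite -(@near_eq_derive _ _ _ (fun=> 0)) ?derive_cst//.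
  near=> s; rewrite w0//; first by near: s; exact: open_nbhs_nbhs.
  by near: s; exact: lt_nbhsr.
apply: (smooth_classS oU RU _ _ (IH w' Sw' w'0)).
  by move=> s s0; exact: (smooth_class_bound (IH w Sw w0)).
move=> k t Ut.
have dw := smooth_class_is_derive k (Sw 1%N) Ut.
have dwX : is_derive t 1 (w k * X k) _ := is_deriveM dw (dX k t Ut).
apply: is_derive_eq; rewrite /GRing.scale/= /w'.
have -> : w k t * (g k t * X k t + h k t) = w k t * g k t * X k t.
  have [tc|ct] := leP t (c k); first by rewrite h0// addr0 mulrA.
  by rewrite w0// !mul0r.
ring.
Unshelve. all: by end_near. Qed.

End growth_classes.

(** * A smooth step *)

Section smooth_step.
Context {R : realType}.

Lemma is_derive_quadratic (f : R -> R) (x l C : R) :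
  (forall h, `|f (x + h) - f x - h * l| <= C * h ^+ 2) -> is_derive x 1 f l.
Proof.
move=> fC.
have cvgl : h^-1 *: ((f \o shift x) (h *: 1) - f x) @[h --> 0^'] --> l.
  apply/cvgrPdist_le => eps eps0.
  have C1 : 0 < C + 1.
    have := fC 1; have := normr_ge0 (f (x + 1) - f x - 1 * l).
    by rewrite expr1n mulr1; lra.
  near=> h.
  have h0 : h != 0 by near: h; exact: nbhs_dnbhs_neq.
  have hle : `|h| <= eps / (C + 1).
    near: h; apply: dnbhs0_le; exact: divr_gt0.
  rewrite /= /GRing.scale/= mulr1 (addrC h).
  have -> : l - h^-1 * (f (x + h) - f x) = - (h^-1 * (f (x + h) - f x - h * l)).
    by field.
  rewrite normrN normrM normfV ler_pdivrMl ?normr_gt0//.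
  rewrite (le_trans (fC h))// -[h ^+ 2]ger0_norm ?sqr_ge0// normrX expr2.
  rewrite mulrCA ler_wpM2l//.
  apply: (@le_trans _ _ ((C + 1) * `|h|)); first by rewrite ler_wpM2r// lerDl.
  by rewrite mulrC -ler_pdivlMr.
by apply: DeriveDef; [apply/cvg_ex; exists l|exact: cvg_lim cvgl].
Unshelve. all: by end_near. Qed.

(** Differentiation stays within linear combinations of this family of functions, so smoothness is
    an induction with [p] free. *)
Definition flat (p : nat) (x : R) : R :=
  if 0 < x then x^-1 ^+ p * expR (- x^-1) else 0.

(** The exponential dominates the single term of degree [p] of its series. *)
Lemma pow_expRN_le (p : nat) (y : R) : 0 <= y -> y ^+ p * expR (- y) <= p`!%:R.
Proof.
move=> y0; rewrite expRN ler_pdivrMr ?expR_gt0//; case: p => [|p].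
  by rewrite expr0 mul1r -(expR0 R) ler_expR.
rewrite mulrC -ler_pdivrMr ?ltr0n ?fact_gt0//.
by apply: le_trans (expR_ge1Dxn p y0); rewrite lerDr.
Qed.

Lemma flat_ge0 p x : 0 <= flat p x.
Proof.
rewrite /flat; case: ifP => // x0.
by rewrite mulr_ge0 ?expR_ge0// exprn_ge0// invr_ge0 ltW.
Qed.

Lemma flat_le p x : flat p x <= p`!%:R.
Proof.
rewrite /flat; case: ifP => // x0.
by apply: pow_expRN_le; rewrite invr_ge0 ltW.
Qed.

Lemma flatS p x : flat p x = x * flat p.+1 x.
Proof.
rewrite /flat; case: ifPn => x0; last by rewrite mulr0.
by rewrite exprS !mulrA divff ?gt_eqF// mul1r.
Qed.

Lemma is_derive_flat p (x : R) :
  is_derive x 1 (flat p) (flat p.+2 x - p%:R * flat p.+1 x).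
Proof.
have [x0|x0|->] := ltgtP x 0.
- have -> : flat p.+2 x - p%:R * flat p.+1 x = 0.
    by rewrite /flat ltNge (ltW x0)/= mulr0 subrr.
  apply: (@near_eq_is_derive _ _ _ (fun=> 0)).
    near=> s; rewrite /flat ltNge (_ : s <= 0)//; apply: ltW.
    by near: s; exact: lt_nbhsl.
- apply: (@near_eq_is_derive _ _ _ ((fun y => y ^+ p * expR (- y)) \o (fun y => y^-1))).
    near=> s; rewrite /flat/= ifT//; near: s; exact: lt_nbhsr.
  have xn0 : x != 0 by rewrite gt_eqF.
  have d1 : is_derive x 1 (fun y : R => y^-1) (- x ^- 2 *: 1).
    exact: is_deriveV.
  have dE : is_derive (x^-1) 1 (fun y : R => expR (- y)) (expR (- x^-1) * -1).
    have dN : is_derive (x^-1) 1 (fun y : R => - y) (-1) by exact: is_deriveN.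
    exact: (is_derive1_comp (is_derive_expR _) dN).
  have dX : is_derive (x^-1) 1 (fun y : R => y ^+ p) ((p%:R * x^-1 ^+ p.-1) *: 1).
    have dI : is_derive (x^-1) 1 (@idfun R) 1 by exact: is_derive_id.
    by rewrite -(exprfctE (@idfun R)); exact: (is_deriveX p dI).
  have d2 : is_derive (x^-1) 1 (fun y : R => y ^+ p * expR (- y)) _ :=
    is_deriveM dX dE.
  have dC := is_derive1_comp d2 d1; apply: is_derive_eq dC _.
  rewrite /flat x0 /GRing.scale/= !mulr1 -exprVn.
  by case: p {dX d2} => [|p] /=; rewrite ?expr0 ?exprS; ring.
(* At 0, [flat p] is [h ^+ 2] times the bounded function [flat p.+2], so the derivative is 0. *)
- apply: (@is_derive_quadratic _ _ _ (p.+2)`!%:R) => h.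
  have flat0 q : flat q 0 = 0 by rewrite /flat ltxx.
  rewrite add0r !flat0 mulr0 subrr mulr0 !subr0.
  rewrite flatS flatS mulrA -expr2 mulrC normrM (@ger0_norm _ (h ^+ 2)) ?sqr_ge0//.
  by rewrite ler_wpM2r ?sqr_ge0// ger0_norm ?flat_ge0// flat_le.
Unshelve. all: by end_near. Qed.

Lemma smooth_class_flat (N : R^nat) n p : (forall k, 1 <= N k) ->
  smooth_class setT (poly_growth N setT) n (fun=> flat p).
Proof.
move=> N1; have PT := poly_growth_additive N1 setT.
have Pcst (x : R) : poly_growth N setT (fun _ _ => x).
  by exists `|x|, 0; split => // k t _; rewrite powRr0 mulr1.
elim: n p => [|n IH] p.
  exists p`!%:R, 0; split => // k t _.
  by rewrite powRr0 mulr1 ger0_norm ?flat_ge0// flat_le.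
apply: (smooth_classS (v := fun _ x => flat p.+2 x + (- p%:R) * flat p.+1 x)
  openT PT (smooth_class_bound (IH p))).
  by move=> k x _; rewrite mulNr; exact: is_derive_flat.
apply: (smooth_class_add openT PT (IH _)).
have Sc := smooth_class_cst openT PT n (Pcst (- p%:R)).
exact: (smooth_class_mul openT PT (@poly_growth_mul _ _ N1 setT) Sc (IH p.+1)).
Qed.

(** The normalised primitive of a bump supported in [[0, 1/2]]. Reaching 1 already at [1/2] lets
    each mode grow with its cut-off fully on during the second half of its growth interval. *)
Lemma smooth_step_exists : exists psi : R -> R,
  [/\ forall x, 0 <= psi x <= 1, forall x, x <= 0 -> psi x = 0,
      forall x, 2^-1 <= x -> psi x = 1 &
      forall (N : R^nat) n, (forall k, 1 <= N k) ->
        smooth_class setT (poly_growth N setT) n (fun=> psi)].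
Proof.
pose rho (x : R) : R := flat 0 x * flat 0 ((-1) * x + 2^-1).
have rho_ge0 x : 0 <= rho x by rewrite mulr_ge0 ?flat_ge0.
have flat0 x : x <= 0 -> flat 0 x = 0 by rewrite /flat ltNge => ->.
have rho0 x : x <= 0 -> rho x = 0 by move=> /flat0 x0; rewrite /rho x0 mul0r.
have rho1 x : 2^-1 <= x -> rho x = 0.
  by move=> x1; rewrite /rho [X in _ * X]flat0 ?mulr0//; lra.
have Srho (N : R^nat) n : (forall k, 1 <= N k) ->
    smooth_class setT (poly_growth N setT) n (fun=> rho).
  move=> N1; have PT := poly_growth_additive N1 setT.
  have S0 := smooth_class_flat n 0 N1.
  have Pm1 : poly_growth N setT (fun _ _ => -1).
    by exists 1, 0; split => // k t _; rewrite normrN normr1 powRr0 mulr1.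
  have S1 := smooth_class_affine N1 (fun=> 2^-1) openT Pm1 S0.
  exact: (smooth_class_mul openT PT (@poly_growth_mul _ _ N1 setT) S0 S1).
have crho : continuous rho.
  move=> x; have S1 := Srho (fun=> 1) 1%N (fun=> lexx _).
  exact: is_derive_continuous (smooth_class_is_derive 0%N S1 (I : setT x)).
have [G Gd] := primitive_exists crho rho0.
have Gmono x y : x <= y -> G x <= G y.
  move=> xy; have [c _ h] := mean_value xy (fun s _ => Gd s).
  by rewrite -subr_ge0 h mulr_ge0// subr_ge0.
have Gconst x y : x <= y -> (forall c, x <= c <= y -> rho c = 0) -> G x = G y.
  move=> xy h; have [c /h c0] := mean_value xy (fun s _ => Gd s).
  by rewrite c0 mul0r => /subr0_eq.
have Gpos : G 0 < G 2^-1.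
  (* The bump is positive on [[1/8, 1/4]], so the mass used for the normalisation is positive. *)
  have q : 8^-1 <= 4^-1 :> R by lra.
  have [c /andP[c1 c2] h] := mean_value q (fun s _ => Gd s).
  have h1 : G 0 <= G 8^-1 by apply: Gmono; lra.
  have h2 : G 4^-1 <= G 2^-1 by apply: Gmono; lra.
  have flat_gt0 x : 0 < x -> 0 < flat 0 x.
    by move=> x0; rewrite /flat x0 mulr_gt0 ?expR_gt0// exprn_gt0// invr_gt0.
  have : 0 < rho c * (4^-1 - 8^-1).
    by rewrite mulr_gt0//; [rewrite mulr_gt0// flat_gt0//; lra|lra].
  by rewrite -h; lra.
pose I := G 2^-1 - G 0; have I0 : 0 < I by rewrite subr_gt0.
pose psi x := I^-1 * (G x - G 0).
have psi0 x : x <= 0 -> psi x = 0.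
  move=> x0; rewrite /psi (Gconst x 0) ?subrr ?mulr0// => c /andP[_]; exact: rho0.
have psi1 x : 2^-1 <= x -> psi x = 1.
  move=> x0; rewrite /psi -(Gconst 2^-1 x) ?mulVf ?gt_eqF// => c /andP[+ _].
  exact: rho1.
have psiM x y : x <= y -> psi x <= psi y.
  by move=> /Gmono xy; rewrite ler_wpM2l ?invr_ge0 ?(ltW I0)// lerD2r.
have psi01 x : 0 <= psi x <= 1.
  apply/andP; split.
    have [x0|/ltW/psiM] := leP x 0; [by rewrite psi0|by rewrite psi0].
  have [x0|/ltW/psiM] := leP 2^-1 x; [by rewrite psi1|by rewrite (psi1 2^-1)].
exists psi; split => // N [|n] N1.
  exists 1, 0; split => // k t _; have /andP[? ?] := psi01 t.
  by rewrite powRr0 mulr1 ger0_norm.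
have PT := poly_growth_additive N1 setT.
have Pb : poly_growth N setT (fun=> psi).
  exists 1, 0; split => // k t _; have /andP[? ?] := psi01 t.
  by rewrite powRr0 mulr1 ger0_norm.
apply: (smooth_classS (v := fun _ t => I^-1 * rho t) openT PT Pb).
  move=> _ t _; have d1 : is_derive t 1 (G - cst (G 0)) (rho t - 0).
    exact: is_deriveB.
  have d2 : is_derive t 1 (I^-1 \*: (G - cst (G 0))) (I^-1 *: (rho t - 0)).
    exact: is_deriveZ.
  by rewrite subr0 in d2.
have Pc : poly_growth N setT (fun _ _ => I^-1).
  by exists `|I^-1|, 0; split => // k t _; rewrite powRr0 mulr1.
have Sc := smooth_class_cst openT PT n Pc.
exact: (smooth_class_mul openT PT (@poly_growth_mul _ _ N1 setT) Sc (Srho N n N1)).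
Qed.

End smooth_step.

(** * Weighted norms *)

Section weighted_norm.
Context {R : realType}.
Variables (N : R^nat) (s : R).
Implicit Types x : R^nat.

Lemma wnorm_le x (C : R) :
  (forall k, N k `^ s * `|x k| <= C) -> (wnorm N s x <= C%:E)%E.
Proof. by move=> xC; apply: ge_ereal_sup => _ [k _ <-]; rewrite lee_fin. Qed.

Lemma le_wnorm x k : ((N k `^ s * `|x k|)%:E <= wnorm N s x)%E.
Proof. by apply: ereal_sup_ubound; exists k. Qed.

Lemma wnorm_ge0 x : (0 <= wnorm N s x)%E.
Proof. by apply: le_trans (le_wnorm x 0%N); rewrite lee_fin mulr_ge0// powR_ge0. Qed.

Lemma in_CsP x : in_Cs N s x <-> exists C, forall k, N k `^ s * `|x k| <= C.
Proof.
split=> [xoo|[C xC]]; last by apply: (le_lt_trans (wnorm_le xC)); rewrite ltry.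
exists (fine (wnorm N s x)) => k; rewrite -lee_fin fineK; first exact: le_wnorm.
by rewrite ge0_fin_numE// wnorm_ge0.
Qed.

Lemma wnorm_cvg0 (T : Type) (F : set_system T) (FF : Filter F) (Z : T -> R^nat)
    (c : T -> R) :
  (\forall h \near F, forall k, N k `^ s * `|Z h k| <= c h) ->
  c h @[h --> F] --> 0 -> (wnorm N s (Z h) @[h --> F] --> 0)%E.
Proof.
move=> Zc c0; apply: (@squeeze_cvge _ _ _ _ (fun=> 0%E) _ (fun h => (c h)%:E)).
- by apply: filterS Zc => h hc; rewrite wnorm_ge0 wnorm_le.
- exact: cvg_cst.
- by apply: cvg_EFin => //; apply: nearW.
Qed.

Lemma wnorm_cvg0_le (T : Type) (F : set_system T) (FF : Filter F)
    (Z : T -> R^nat) (eps : R) : 0 < eps ->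
  (wnorm N s (Z h) @[h --> F] --> 0)%E ->
  \forall h \near F, forall k, N k `^ s * `|Z h k| <= eps.
Proof.
move=> eps0 Z0.
have oe : nbhs (0%E : \bar R) [set x : \bar R | (x < eps%:E)%E].
  by apply: open_nbhs_nbhs; split; [exact: open_ereal_lt_ereal|rewrite /= lte_fin].
have h1 : F [set h | (wnorm N s (Z h) < eps%:E)%E] := Z0 _ oe.
apply: (@filterS T F FF _ _ _ h1) => h /= Zh k.
by rewrite -lee_fin (le_trans (le_wnorm _ k))// ltW.
Qed.

Lemma continuous_in_CsP (D : set R) (X : R -> R^nat) :
  continuous_in_Cs N s D X <->
  forall t, D t -> in_Cs N s (X t) /\ forall eps, 0 < eps ->
    exists2 d, 0 < d & forall u, D u -> `|u - t| < d ->
      forall k, N k `^ s * `|X u k - X t k| <= eps.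
Proof.
split=> XC t Dt; have [Xt h] := XC t Dt; split => //.
  move=> eps eps0.
  have nt : nbhs t [set u | D u -> forall k, N k `^ s * `|(X u - X t) k| <= eps].
    exact: (wnorm_cvg0_le (within_filter D _) eps0 h).
  have /nbhs_ballP[d /= d0 dP] := nt; exists d => // u Du ut k.
  by apply: dP => //; rewrite /ball/= distrC.
have FF : Filter (within D (nbhs t)) by exact: within_filter.
have near_le (eps : R) : 0 < eps ->
    \forall u \near within D (nbhs t), (wnorm N s (X u - X t)%R <= eps%:E)%E.
  move=> eps0; have [d d0 dP] := h _ eps0.
  suff nt : nbhs t [set u | D u -> (wnorm N s (X u - X t)%R <= eps%:E)%E] by [].
  apply/nbhs_ballP; exists d => //= u ut Du; apply: wnorm_le => k.
  by apply: dP => //; rewrite distrC.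
apply: (iffRL (@fine_cvgP _ _ _ FF (fun u => wnorm N s (X u - X t)) 0)).
split.
  apply: filterS (near_le 1 ltr01) => u hu.
  by rewrite ge0_fin_numE ?wnorm_ge0// (le_lt_trans hu) ?ltry.
apply/cvgrPdist_le => eps eps0; apply: filterS (near_le eps eps0) => u hu.
rewrite sub0r normrN ger0_norm ?fine_ge0 ?wnorm_ge0//= -lee_fin fineK//.
by rewrite ge0_fin_numE ?wnorm_ge0// (le_lt_trans hu) ?ltry.
Qed.

End weighted_norm.

Lemma norm_diff_le (R : realType) (f df : R -> R) (C : R) :
  (forall x : R, is_derive x 1 f (df x)) -> (forall x, `|df x| <= C) ->
  forall x y, `|f x - f y| <= C * `|x - y|.
Proof.
move=> fd dfC x y; wlog yx : x y / y <= x.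
  move=> h; have [|/ltW yx] := leP y x; first exact: h.
  by rewrite distrC (distrC x); exact: h.
rewrite (ger0_norm (_ : 0 <= x - y)) ?subr_ge0//.
exact: (norm_increment_le yx (fun z _ => fd z)).
Qed.

(** Two mean value estimates. With [C] independent of the mode, difference quotients of weighted
    modes converge uniformly in the mode, that is, in the [C^s] norm. *)
Lemma norm_taylor1_le (R : realType) (f df ddf : R -> R) (C : R) :
  (forall x : R, is_derive x 1 f (df x)) ->
  (forall x : R, is_derive x 1 df (ddf x)) -> (forall x, `|ddf x| <= C) ->
  forall x h, h != 0 -> `|h^-1 * (f (x + h) - f x) - df x| <= C * `|h|.
Proof.
move=> fd dfd ddfC x h h0.
have C0 : 0 <= C := le_trans (normr_ge0 _) (ddfC x).
have [c cx hc] : exists2 c, `|c - x| <= `|h| & f (x + h) - f x = df c * h.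
  have [h1|h1] := leP 0 h.
    have xh : x <= x + h by rewrite lerDl.
    have [c /andP[c1 c2] E] := mean_value xh (fun z _ => fd z).
    exists c; last by rewrite E; ring.
    by rewrite (ger0_norm h1) ger0_norm; lra.
  have xh : x + h <= x by lra.
  have [c /andP[c1 c2] E] := mean_value xh (fun z _ => fd z).
  exists c; last by rewrite -(opprB (f x)) E; ring.
  by rewrite (ltr0_norm h1) ler0_norm; lra.
rewrite hc mulrCA mulVf// mulr1.
by rewrite (le_trans (norm_diff_le dfd ddfC _ _))// ler_wpM2l.
Qed.

Lemma smooth_in_CinftyP (R : realType) (N : R^nat) (D : set R) (f : R -> R^nat) :
  (forall n, smooth_class setT (rapid_decay N setT) n (fun k t => f t k)) ->
  smooth_in_Cinfty N D f.
Proof.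
move=> Sf; pose u n k := derive1n n (fun t => f t k).
have Su n m : smooth_class setT (rapid_decay N setT) m (u n).
  exact: smooth_class_derive1n (Sf (n + m)%N).
have du n k (t : R) : is_derive t 1 (u n k) (u n.+1 k t).
  exact: (smooth_class_is_derive k (Su n 1%N)).
exists (fun n t k => u n k t); split => // [n t _ s s0|n t _ s s0].
  have [C C0 uC] := smooth_class_bound (Su n 0%N) s (ltW s0).
  by apply/in_CsP; exists C => k; exact: uC.
(* A weighted bound on the derivative of order [n.+2], uniform in time and mode, gives a linear rate
   for the difference quotients of the derivative of order [n]. *)
have [C C0 uC] := smooth_class_bound (Su n.+2 0%N) s (ltW s0).
have FF : Filter (increment_filter D t) by exact: within_filter.
apply: (@wnorm_cvg0 _ _ _ _ _ _ _ (fun h => C * `|h|)).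
  apply: (cvg_within (F := 0^')); near=> h => k.
  have h0 : h != 0 by near: h; exact: nbhs_dnbhs_neq.
  have N0 : 0 <= N k `^ s := powR_ge0 _ _.
  rewrite -[X in X * _]ger0_norm// -normrM.
  rewrite [X in `|X|](_ : _ = h^-1 * (N k `^ s * u n k (t + h) - N k `^ s * u n k t)
    - N k `^ s * u n.+1 k t); last by rewrite !fctE /GRing.scale/=; ring.
  have dNu m (x : R) : is_derive x 1 (N k `^ s \*: u m k) (N k `^ s *: u m.+1 k x).
    exact: is_deriveZ.
  apply: (norm_taylor1_le (dNu n) (dNu n.+1) _ _ h0) => x.
  by rewrite normrM ger0_norm// uC.
rewrite -(mulr0 C); apply: cvgM; first exact: cvg_cst.
rewrite -(normr0 R); apply: cvg_norm.
by apply: cvg_within_filter; exact: nbhs_dnbhs.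
Unshelve. all: by end_near. Qed.

(** * Uniqueness *)

(* The integrating factor [exp (c t)] makes the dissipation harmless: the bound
   does not depend on [c]. *)
Lemma dissipative_bound (R : realType) (z q : R -> R) (c Q a b : R) :
  a <= b -> 0 <= c -> 0 <= Q -> {within `[a, b], continuous z} -> z a = 0 ->
  (forall t, a < t < b -> is_derive t 1 z (- c * z t + q t)) ->
  (forall t, a < t < b -> `|q t| <= Q) -> `|z b| <= Q * (b - a).
Proof.
move=> ab c0 Q0.
(* A one-sided bound suffices, since [- z] satisfies the same hypotheses with [- q]. *)
suff upper (y p : R -> R) : {within `[a, b], continuous y} -> y a = 0 ->
  (forall t, a < t < b -> is_derive t 1 y (- c * y t + p t)) ->
  (forall t, a < t < b -> `|p t| <= Q) -> y b <= Q * (b - a).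
  move=> zc za zd qQ; rewrite ler_norml; apply/andP; split; last first.
    exact: upper zc za zd qQ.
  rewrite lerNl.
  apply: (upper (fun t => - z t) (fun t => - q t)).
  - by move=> x; apply: continuousN; exact: zc.
  - by rewrite za oppr0.
  - move=> t tab; have dz := zd t tab.
    have dN : is_derive t 1 (- z) (- (- c * z t + q t)) by exact: is_deriveN.
    by apply: is_derive_eq dN _; ring.
  - by move=> t tab; rewrite normrN qQ.
move=> yc ya yd pQ.
(* [Q * (t - a)] is a supersolution: with the integrating factor, the difference [W] starts at 0 and
   has nonpositive derivative. *)
pose W := (fun t => expR (c * t) * (y t - Q * (t - a))) : R -> R.
have dE (t : R) : is_derive t 1 (fun t : R => expR (c * t)) (expR (c * t) * c).
  have dl : is_derive t 1 (c \*: @idfun R) (c *: 1) by exact: is_deriveZ.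
  have dc := is_derive1_comp (is_derive_expR (c * t)) dl.
  by rewrite /GRing.scale/= mulr1 in dc.
have dW (t : R) : a < t < b -> is_derive t 1 W
    (expR (c * t) * (p t - Q - c * (Q * (t - a)))).
  move=> tab; have dy := yd t tab.
  have dl : is_derive t 1 (Q \*: (@idfun R - cst a)) (Q *: (1 - 0)).
    by apply: is_deriveZ; exact: is_deriveB.
  have dB : is_derive t 1 (y - Q \*: (@idfun R - cst a)) _ := is_deriveB dy dl.
  have dM := is_deriveM (dE t) dB.
  apply: is_derive_eq dM _; rewrite /GRing.scale/= !fctE/= /GRing.scale/=; ring.
have h : W b <= W a.
  apply: (@ler0_derive1_le_cc R W a b); rewrite ?in_itv/= ?lexx ?ab//.
  - by move=> t; rewrite in_itv/= => /dW[].
  - move=> t; rewrite in_itv/= => tab; have [_ dv] := dW t tab.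
    rewrite derive1E dv mulr_ge0_le0 ?expR_ge0//.
    have := pQ t tab; rewrite ler_norml => /andP[_ p1].
    have : 0 <= c * (Q * (t - a)).
      by move/andP: tab => [ta _]; rewrite !mulr_ge0// subr_ge0 ltW.
    lra.
  - have cE : continuous (fun t : R => expR (c * t)).
      by move=> t; exact: is_derive_continuous (dE t).
    have cl : continuous (fun t : R => Q * (t - a)).
      by move=> t; apply: cvgM; [exact: cvg_cst|apply: cvgB => //; exact: cvg_cst].
    move=> x; apply: cvgM; first exact: (@continuous_subspaceT _ _ `[a, b]%classic _ cE x).
    apply: cvgB; first exact: yc.
    exact: (@continuous_subspaceT _ _ `[a, b]%classic _ cl x).
move: h; rewrite /W ya subrr mulr0 subr0 mulr0 pmulr_rle0 ?expR_gt0//.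
by rewrite subr_le0.
Qed.

Lemma time_itv_extend (R : realType) (T : \bar R) (t : R) : time_itv T t ->
  exists2 d : R, 0 < d & forall u, 0 <= u -> u <= t + d -> time_itv T u.
Proof.
move=> [t0 tT]; case: T tT => [T| |] //=.
  rewrite lte_fin => tT; exists ((T - t) / 2); first by lra.
  by move=> u u0 ut; split => //; rewrite lte_fin; lra.
by move=> _; exists 1 => // u u0 _; split => //; rewrite ltry.
Qed.

Lemma time_itv_le (R : realType) (T : \bar R) (t u : R) :
  time_itv T t -> 0 <= u -> u <= t -> time_itv T u.
Proof.
by move=> [_ tT] u0 ut; split => //; apply: le_lt_trans tT; rewrite lee_fin.
Qed.

Lemma time_itv_nbhs (R : realType) (T : \bar R) (t : R) :
  time_itv T t -> 0 < t -> \forall u \near t, time_itv T u.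
Proof.
move=> Tt t0; have [d d0 dP] := time_itv_extend Tt; have td : t < t + d by rewrite ltrDl.
near=> u; apply: dP.
  by near: u; apply: filterS (lt_nbhsr t0) => x; exact: ltW.
by near: u; apply: filterS (lt_nbhsl td) => x; exact: ltW.
Unshelve. all: by end_near. Qed.

Lemma increment_is_derive (R : realType) (T : \bar R) (f : R -> R) (t l : R) :
  time_itv T t -> 0 < t ->
  h^-1 * (f (t + h) - f t) @[h --> increment_filter (time_itv T) t] --> l ->
  is_derive t 1 f l.
Proof.
move=> Tt t0 fl.
have cvgl : h^-1 *: ((f \o shift t) (h *: 1) - f t) @[h --> 0^'] --> l.
  move=> A /fl Al.
  have /nbhs_ballP[d /= d0 dP] := time_itv_nbhs Tt t0.
  have Bd : \forall h \near 0^', time_itv T (t + h).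
    have : \forall h \near (0 : R)^', `|h| < d by exact: dnbhs0_lt.
    by apply: filterS => h hd; apply: dP; rewrite /ball/= opprD addNKr normrN.
  have Al' : \forall h \near (0:R)^', time_itv T (t + h) -> A (h^-1 * (f (t + h) - f t)) := Al.
  apply: filterS2 Bd Al' => h h1 /(_ h1); rewrite /= /GRing.scale/= mulr1.
  by rewrite (addrC h).
by apply: DeriveDef; [apply/cvg_ex; exists l|exact: cvg_lim cvgl].
Qed.

Section uniqueness.
Context {R : realType}.
Variables (N : R^nat) (nu alpha : R) (X0 : R^nat) (f : R -> R^nat).
Hypotheses (N_ge1 : forall k, 1 <= N k) (N_leS : forall k, N k <= N k.+1)
  (nu_ge0 : 0 <= nu) (alpha_gt0 : 0 < alpha).

Let Nle k : N k `^ alpha <= N k.+1 `^ alpha.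
Proof.
by apply: ge0_ler_powR; rewrite ?nnegrE ?(ltW alpha_gt0) ?(le_trans ler01 (N_ge1 _)).
Qed.

(** Continuity in [C^alpha]. The weight is exactly the coefficient of the nonlinearity, which
    thereby becomes Lipschitz for the sup norm over modes. *)
Let solution_bound T X t : obukhov_solution N nu alpha X0 f T X -> time_itv T t ->
  exists d B, [/\ 0 < d, 0 <= B & forall u k, time_itv T u -> `|u - t| < d ->
    N k `^ alpha * `|X u k| <= B].
Proof.
move=> [_ Xc _] Tt.
have [/in_CsP[B XB] h] := (iffLR (continuous_in_CsP _ _ _ _) (Xc _ alpha_gt0)) t Tt.
have [d d0 dP] := h 1 ltr01; exists d, (B + 1); split => //.
  by rewrite addr_ge0// (le_trans _ (XB 0%N))// mulr_ge0// powR_ge0.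
move=> u k Tu ud; have h1 := dP u Tu ud k; have h2 := XB k.
rewrite -(subrK (X t k) (X u k)) (le_trans (ler_wpM2l (powR_ge0 _ _) (ler_normD _ _)))//.
by rewrite mulrDr addrC lerD.
Qed.

Let solution_cont T X a b k : obukhov_solution N nu alpha X0 f T X -> 0 <= a ->
  time_itv T b -> {within `[a, b], continuous (fun t => X t k)}.
Proof.
move=> [_ Xc _] a0 Tb; apply/subspace_continuousP => t /=.
rewrite in_itv/= => /andP[at_ tb].
have TT u : a <= u -> u <= b -> time_itv T u.
  by move=> au ub; apply: time_itv_le Tb _ ub; exact: le_trans au.
have [_ h] := (iffLR (continuous_in_CsP _ _ _ _) (Xc _ alpha_gt0)) t (TT _ at_ tb).
apply/cvgrPdist_le => eps eps0; have [d d0 dP] := h eps eps0.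
suff : nbhs t [set u | `[a, b]%classic u -> `|X t k - X u k| <= eps] by [].
apply/nbhs_ballP; exists d => //= u; rewrite /ball/= in_itv/= => ut /andP[au ub].
have := dP u (TT _ au ub) (eq_ind _ (fun x => x < d) ut _ (distrC _ _)) k.
rewrite distrC; apply: le_trans; apply: ler_peMl => //.
by rewrite -(powRr0 (N k)) ler_powR// ltW.
Qed.

(** The difference of two solutions obeys in each mode a damped linear equation with source at most
    [4 * B] times the sup-norm difference. On a time at most [d5], each use of [dissipative_bound]
    halves the bound on this difference, starting from [2 * B]. *)
Lemma obukhov_unique_local T1 T2 X Y t0 :
  obukhov_solution N nu alpha X0 f T1 X -> obukhov_solution N nu alpha X0 f T2 Y ->
  time_itv T1 t0 -> time_itv T2 t0 -> X t0 = Y t0 ->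
  exists2 d, 0 < d & forall t, t0 <= t -> t <= t0 + d -> X t = Y t.
Proof.
move=> sX sY T1t T2t XY0.
have t0_ge0 : 0 <= t0 by case: T1t.
have [d1 d1_gt0 D1] := time_itv_extend T1t.
have [d2 d2_gt0 D2] := time_itv_extend T2t.
have [d3 [B1 [d3_gt0 B1_ge0 XB]]] := solution_bound sX T1t.
have [d4 [B2 [d4_gt0 B2_ge0 YB]]] := solution_bound sY T2t.
pose B := Num.max B1 B2.
have B0 : 0 <= B by rewrite le_max B1_ge0.
(* Chosen so that [4 * B * d5 <= 1 / 2]. *)
pose d5 := (8 * (B + 1))^-1.
have B8 : 0 < 8 * (B + 1) by rewrite mulr_gt0// ltr_wpDl.
have d5_gt0 : 0 < d5 by rewrite invr_gt0.
pose d := Num.min (Num.min d1 d2) (Num.min (Num.min (d3 / 2) (d4 / 2)) d5).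
have d_gt0 : 0 < d by rewrite !lt_min d1_gt0 d2_gt0 d5_gt0 !divr_gt0.
have dd1 : d <= d1 by rewrite /d !ge_min lexx.
have dd2 : d <= d2 by rewrite /d !ge_min lexx !orbT.
have dd3 : d <= d3 / 2 by rewrite /d !ge_min lexx !orbT.
have dd4 : d <= d4 / 2 by rewrite /d !ge_min lexx !orbT.
have dd5 : d <= d5 by rewrite /d !ge_min lexx !orbT.
have T1u u : t0 <= u -> u <= t0 + d -> time_itv T1 u.
  by move=> h1 h2; apply: D1; lra.
have T2u u : t0 <= u -> u <= t0 + d -> time_itv T2 u.
  by move=> h1 h2; apply: D2; lra.
have Xb u k : t0 <= u -> u <= t0 + d -> N k `^ alpha * `|X u k| <= B.
  move=> h1 h2; rewrite le_max XB//; first exact: T1u.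
  by rewrite ger0_norm; lra.
have Yb u k : t0 <= u -> u <= t0 + d -> N k `^ alpha * `|Y u k| <= B.
  move=> h1 h2; rewrite le_max YB ?orbT//; first exact: T2u.
  by rewrite ger0_norm; lra.
have Na k : 1 <= N k `^ alpha by rewrite -(powRr0 (N k)) ler_powR// ltW.
exists d => //.
suff main n : forall t k, t0 <= t -> t <= t0 + d ->
    `|X t k - Y t k| <= 2 * B / 2 ^+ n.
  move=> t h1 h2; apply/funext => k; apply/subr0_eq/eqP; rewrite -normr_le0.
  apply/ler_addgt0Pr => eps eps0; rewrite add0r.
  have : (2 * B) * (2^-1) ^+ n @[n --> \oo] --> 2 * B * 0.
    by apply: cvgM; [exact: cvg_cst|apply: cvg_expr; rewrite ger0_norm; lra].
  rewrite mulr0 => /cvgrPdist_le /(_ _ eps0)[m _ /(_ m (leqnn _))].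
  rewrite sub0r normrN => h; rewrite (le_trans (main m t k h1 h2))//.
  rewrite (le_trans _ h)// -exprVn; exact: ler_norm.
elim: n => [|n IH] t k h1 h2.
  rewrite expr0 divr1 (le_trans (ler_normB _ _))// mulr2n mulrDl mul1r.
  apply: lerD; [apply: le_trans (Xb t k h1 h2)|apply: le_trans (Yb t k h1 h2)];
    exact: ler_peMl.
set m := 2 * B / 2 ^+ n in IH.
have m0 : 0 <= m := le_trans (normr_ge0 _) (IH t k h1 h2).
(* The differences of products are factored so that each power of a frequency multiplies [X] or [Y]
   at the same or a higher mode, where [B] controls it. *)
pose q u := (if k is j.+1 then N j `^ alpha *
    (X u j * (X u k - Y u k) + (X u j - Y u j) * Y u k) else 0)
  - N k `^ alpha * ((X u k.+1 + Y u k.+1) * (X u k.+1 - Y u k.+1)).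
have qm u : t0 < u < t -> `|q u| <= 4 * B * m.
  move=> /andP[u1 u2]; have u1' := ltW u1.
  have u2' : u <= t0 + d by rewrite (le_trans (ltW u2)).
  have IHu j : `|X u j - Y u j| <= m by exact: IH.
  have prodb (a x y : R) : 0 <= a -> a * `|x| <= B -> `|y| <= m -> `|a * (x * y)| <= B * m.
    move=> a0 ax ym; rewrite mulrA normrM ler_pM//.
    by rewrite normrM ger0_norm.
  have N0 j : 0 <= N j `^ alpha := powR_ge0 _ _.
  rewrite (_ : 4 * B * m = (B * m + B * m) + (B * m + B * m)); last by ring.
  rewrite /q (le_trans (ler_normB _ _))// lerD//; last first.
    rewrite mulrDl mulrDr (le_trans (ler_normD _ _))// lerD//; apply: prodb => //.
      by apply: le_trans (Xb u k.+1 u1' u2'); rewrite ler_wpM2r.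
    by apply: le_trans (Yb u k.+1 u1' u2'); rewrite ler_wpM2r.
  case: (k) => [|j]; first by rewrite normr0 !addr_ge0// mulr_ge0.
  rewrite mulrDr (le_trans (ler_normD _ _))// lerD//; first by apply: prodb => //; exact: Xb.
  rewrite [X in _ * X]mulrC; apply: prodb => //.
  by apply: le_trans (Yb u j.+1 u1' u2'); rewrite ler_wpM2r.
have Zc : {within `[t0, t], continuous (fun u => X u k - Y u k)}.
  move=> u; apply: cvgB.
    exact: (@solution_cont _ _ _ _ k sX t0_ge0 (T1u _ h1 h2) u).
  exact: (@solution_cont _ _ _ _ k sY t0_ge0 (T2u _ h1 h2) u).
have Zd u : t0 < u < t ->
    is_derive u 1 (fun u => X u k - Y u k) (- (nu * N k ^+ 2) * (X u k - Y u k) + q u).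
  move=> /andP[u1 u2].
  have u0 : 0 < u by rewrite (le_lt_trans t0_ge0).
  have u2' : u <= t0 + d by rewrite (le_trans (ltW u2)).
  have [_ _ dX] := sX; have [_ _ dY] := sY.
  have T1u' := T1u u (ltW u1) u2'; have T2u' := T2u u (ltW u1) u2'.
  have dXu := increment_is_derive (f := fun v => X v k) T1u' u0 (dX u k T1u').
  have dYu := increment_is_derive (f := fun v => Y v k) T2u' u0 (dY u k T2u').
  have dB : is_derive u 1 ((fun u => X u k) - (fun u => Y u k)) _ := is_deriveB dXu dYu.
  apply: is_derive_eq dB _; rewrite /obukhov_rhs /q.
  by case: (k) => [|j]; ring.
have c0 : 0 <= nu * N k ^+ 2 by rewrite mulr_ge0// sqr_ge0.
have Q0 : 0 <= 4 * B * m by rewrite !mulr_ge0.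
have Z0 : X t0 k - Y t0 k = 0 by rewrite XY0 subrr.
have := dissipative_bound h1 c0 Q0 Zc Z0 Zd qm.
move=> /le_trans; apply.
have -> : 2 * B / 2 ^+ n.+1 = m / 2 by rewrite /m exprSr invfM mulrA.
have td : t - t0 <= d5 by lra.
apply: (@le_trans _ _ (4 * B * m * d5)).
  by rewrite ler_wpM2l.
rewrite (_ : 4 * B * m * d5 = m * (4 * B * d5)); last by ring.
rewrite ler_wpM2l// /d5 ler_pdivrMr//; lra.
Qed.

(** At the infimum [t0] of the times of disagreement the solutions still agree, by the initial
    condition or by continuity from the left; local uniqueness from [t0] then contradicts the
    infimum. *)
Lemma obukhov_unique T1 T2 X Y :
  obukhov_solution N nu alpha X0 f T1 X -> obukhov_solution N nu alpha X0 f T2 Y ->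
  forall t, time_itv T1 t -> time_itv T2 t -> X t = Y t.
Proof.
move=> sX sY t1 T1t1 T2t1; have t1_ge0 : 0 <= t1 by case: T1t1.
apply: contrapT => neq1.
pose S := [set t | [/\ 0 <= t, t <= t1 & X t <> Y t]].
have S1 : S t1 by split.
have lbS : lbound S 0 by move=> x [].
have hS : has_inf S by split; [exists t1|exists 0].
set t0 := inf S.
have t0_ge0 : 0 <= t0 by apply: lb_le_inf => //; exists t1.
have t01 : t0 <= t1 by apply: ge_inf => //; exists 0.
have T1t0 := time_itv_le T1t1 t0_ge0 t01.
have T2t0 := time_itv_le T2t1 t0_ge0 t01.
have before t : 0 <= t -> t < t0 -> X t = Y t.
  move=> h1 h2; apply: contrapT => h3.
  have : t0 <= t.
    by apply: ge_inf; [exists 0|split=> //; exact: le_trans (ltW h2) t01].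
  by rewrite leNgt h2.
have at0 : X t0 = Y t0.
  have [t0E|t0_neq] := eqVneq t0 0.
    by have [XE _ _] := sX; have [YE _ _] := sY; rewrite t0E XE YE.
  have t0_gt0 : 0 < t0 by rewrite lt_neqAle eq_sym t0_neq.
  apply/funext => k; apply/subr0_eq/eqP; rewrite -normr_le0.
  apply/ler_addgt0Pr => eps eps0; rewrite add0r.
  have [_ Xc _] := sX; have [_ Yc _] := sY.
  have [_ hX] := (iffLR (continuous_in_CsP _ _ _ _) (Xc _ alpha_gt0)) t0 T1t0.
  have [_ hY] := (iffLR (continuous_in_CsP _ _ _ _) (Yc _ alpha_gt0)) t0 T2t0.
  have e2 : 0 < eps / 2 by rewrite divr_gt0.
  have [d1 d1_gt0 D1] := hX _ e2; have [d2 d2_gt0 D2] := hY _ e2.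
  pose t := Num.max 0 (t0 - Num.min d1 d2 / 2).
  have m0 : 0 < Num.min d1 d2 by rewrite lt_min d1_gt0.
  have tt0 : t < t0 by rewrite gt_max t0_gt0/= gtrBl divr_gt0.
  have t_ge0 : 0 <= t by rewrite le_max lexx.
  have tm : `|t - t0| < Num.min d1 d2.
    rewrite ltr0_norm ?subr_lt0// opprB.
    have : t0 - Num.min d1 d2 / 2 <= t by rewrite le_max lexx orbT.
    lra.
  move: (tm); rewrite lt_min => /andP[td1 td2].
  have h1 := D1 t (time_itv_le T1t0 t_ge0 (ltW tt0)) td1 k.
  have h2 := D2 t (time_itv_le T2t0 t_ge0 (ltW tt0)) td2 k.
  have Na : 1 <= N k `^ alpha by rewrite -(powRr0 (N k)) ler_powR// ltW.
  have h1' := le_trans (ler_peMl (normr_ge0 _) Na) h1.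
  have h2' := le_trans (ler_peMl (normr_ge0 _) Na) h2.
  rewrite -(before t t_ge0 tt0) in h2'.
  move: h1' h2'; rewrite !ler_norml => /andP[? ?] /andP[? ?].
  by apply/andP; split; lra.
have [d d_gt0 dP] := obukhov_unique_local sX sY T1t0 T2t0 at0.
have [t St tlt] := inf_adherent d_gt0 hS.
have t0t : t0 <= t by apply: ge_inf => //; exists 0.
by have [_ _] := St; apply; apply: dP => //; rewrite ltW.
Qed.

End uniqueness.

(** * From a profile to a blow-up *)

Section blowup.
Context {R : realType}.
Variables (N : R^nat) (b nu alpha s T E : R) (tm mid : R^nat).
Variables (chi X : nat -> R -> R).
Let U : set R := [set t | t < T].
Let a (k : nat) : R := if k is j.+1 then N j `^ alpha else 0.
(** The profile solves [X' = g X + h] in each mode: [g] collects gain and viscosity behind the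
    cut-off, and [h] is the loss, which is zero up to [mid k]. *)
Let g (k : nat) (t : R) : R := chi k t * (a k * X k.-1 t - nu * N k ^+ 2).
Let h (k : nat) (t : R) : R := - (chi k.+1 t * (N k `^ alpha * X k.+1 t ^+ 2)).
Hypotheses (N_ge1 : forall k, 1 <= N k) (b_ge0 : 0 <= b)
  (N_leS : forall k, N k <= N k.+1) (N_geS : forall k, N k.+1 <= N k `^ b)
  (nu_ge0 : 0 <= nu) (alpha_gt0 : 0 < alpha) (s_gt0 : 0 < s)
  (tm_ge0 : forall k, 0 <= tm k) (tm_ltT : forall k, tm k < T)
  (tm_cvg : forall t, t < T -> exists k0, forall k, (k0 <= k)%N -> t < tm k)
  (tm_mid : forall k, tm k <= mid k) (mid_tm : forall k, mid k <= tm k.+1)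
  (chi_eq0 : forall k t, t <= tm k -> chi k t = 0)
  (chi_eq1 : forall k t, mid k <= t -> chi k t = 1)
  (Schi : forall n, smooth_class U (poly_growth N U) n chi)
  (X_gt0 : forall k t, 0 < X k t) (X_le : forall k t, X k t <= E)
  (dX : forall k (t : R), t < T -> is_derive t 1 (X k) (g k t * X k t + h k t))
  (early : forall q, 0 <= q -> exists2 C, 0 <= C &
     forall k t, U t -> t <= mid k -> N k `^ q * `|X k t| <= C)
  (peak : forall B, exists k0, forall k, (k0 <= k)%N ->
     B < N k `^ s * X k (tm k.+1)).

Let oU : open U. Proof. exact: open_lt. Qed.
Let PU := poly_growth_additive N_ge1 U.
Let RU := rapid_decay_additive N U.
Let E_ge0 : 0 <= E := ltW (lt_le_trans (X_gt0 0 0) (X_le 0 0)).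

Let PM n u v : smooth_class U (poly_growth N U) n u ->
  smooth_class U (poly_growth N U) n v ->
  smooth_class U (poly_growth N U) n (fun k t => u k t * v k t).
Proof. exact: (smooth_class_mul oU PU (@poly_growth_mul _ _ N_ge1 U)). Qed.

Let Pcst n (c : nat -> R) (C p : R) : 0 <= C -> 0 <= p ->
  (forall k, `|c k| <= C * N k `^ p) ->
  smooth_class U (poly_growth N U) n (fun k _ => c k).
Proof.
by move=> C0 p0 cC; apply: (smooth_class_cst oU PU); exact: poly_growth_cst cC.
Qed.

Let Sa n : smooth_class U (poly_growth N U) n (fun k _ => a k).
Proof.
apply: (@Pcst n a 1 alpha) => // [|[|k]]; first exact: ltW.
  by rewrite normr0 mul1r powR_ge0.
rewrite mul1r ger0_norm ?powR_ge0//.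
by apply: ge0_ler_powR; rewrite ?nnegrE ?(ltW alpha_gt0) ?(le_trans ler01 (N_ge1 _)).
Qed.

Let SN n : smooth_class U (poly_growth N U) n (fun k _ => N k `^ alpha).
Proof.
apply: (@Pcst n _ 1 alpha) => //; first exact: ltW.
by move=> k; rewrite mul1r ger0_norm ?powR_ge0.
Qed.

Let Sv n : smooth_class U (poly_growth N U) n (fun k _ => - (nu * N k ^+ 2)).
Proof.
apply: (@Pcst n _ nu 2%:R) => // k.
rewrite normrN normrM ger0_norm// ler_wpM2l// powR_mulrn ?(le_trans ler01 (N_ge1 _))//.
by rewrite ger0_norm ?sqr_ge0.
Qed.

Let S1 n (u : nat -> R -> R) : smooth_class U (poly_growth N U) n u ->
  smooth_class U (poly_growth N U) n (fun k t => 1 - u k t).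
Proof.
move=> Su.
have c1 : forall k : nat, `|1 : R| <= 1 * N k `^ 0.
  by move=> k; rewrite powRr0 mulr1 normr1.
have cN1 : forall k : nat, `|-1 : R| <= 1 * N k `^ 0.
  by move=> k; rewrite normrN.
have SN1 := PM (Pcst n ler01 (lexx 0) cN1) Su.
have := smooth_class_add oU PU (Pcst n ler01 (lexx 0) c1) SN1.
by apply: (smooth_class_ext oU PU) => k t _; rewrite mulN1r.
Qed.

Let succP n u : smooth_class U (poly_growth N U) n u ->
  smooth_class U (poly_growth N U) n (fun k => u k.+1).
Proof.
apply: smooth_class_reindex => v; exact: (poly_growth_succ N_ge1 b_ge0 N_geS).
Qed.

Let predP n u : smooth_class U (poly_growth N U) n u ->
  smooth_class U (poly_growth N U) n (fun k => u k.-1).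
Proof. by apply: smooth_class_reindex => v; exact: poly_growth_pred. Qed.

Let Sgh n : smooth_class U (poly_growth N U) n X ->
  smooth_class U (poly_growth N U) n g /\ smooth_class U (poly_growth N U) n h.
Proof.
move=> SX; split.
  exact/(PM (Schi n))/(smooth_class_add oU PU _ (Sv n))/(PM (Sa n))/predP.
have SXX := PM (succP SX) (succP SX).
have := PM (Pcst n ler01 (lexx 0) (fun k => _ : `|-1 : R| <= 1 * N k `^ 0))
  (PM (succP (Schi n)) (PM (SN n) SXX)).
move=> SH; apply: (smooth_class_ext oU PU _ (SH _)) => [k t _|k].
  by rewrite mulN1r.
by rewrite normrN powRr0 mulr1 normr1.
Qed.

(** Bootstrap: [X] is bounded, and the equation writes its derivative through products of [X], its
    shifts and symbols. *)
Let SX n : smooth_class U (poly_growth N U) n X.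
Proof.
have PX : poly_growth N U X.
  exists E, 0; split => // k t _.
  by rewrite powRr0 mulr1 ger0_norm ?X_le// ltW.
elim: n => [|n IH]; first exact: PX.
have [Sg Sh] := Sgh IH.
by apply: (smooth_classS oU PU PX dX); exact: (smooth_class_add oU PU (PM Sg IH) Sh).
Qed.

Let Sg n := (Sgh (SX n)).1.

Let h_eq0 k t : U t -> t <= mid k -> h k t = 0.
Proof.
by move=> _ tk; rewrite /h chi_eq0 ?mul0r ?oppr0// (le_trans tk).
Qed.

(** Up to [t1 < T] all but finitely many modes are before their starting time, where the early bound
    applies; the others have frequency at most [N k0], so polynomial growth gives a constant. *)
Let locally_rapid (u : nat -> R -> R) q t1 : 0 <= q -> t1 < T ->
  poly_growth N U u ->
  (exists2 C, 0 <= C & forall k t, U t -> t <= mid k -> N k `^ q * `|u k t| <= C) ->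
  exists2 C, 0 <= C & forall k t, t <= t1 -> N k `^ q * `|u k t| <= C.
Proof.
move=> q0 t1T [C [p [C0 p0 uC]]] [D D0 uD].
have [k0 k0P] := tm_cvg t1T; exists (N k0 `^ q * (C * N k0 `^ p) + D).
  by rewrite addr_ge0// !mulr_ge0// powR_ge0.
move=> k t tt1; have Ut : U t by exact: le_lt_trans t1T.
have [kk0|/ltnW kk0] := leqP k0 k.
  apply: (@le_trans _ _ D); last by rewrite lerDr !mulr_ge0// powR_ge0.
  by apply: uD => //; apply: le_trans tt1 (le_trans (ltW (k0P k kk0)) (tm_mid k)).
apply: (@le_trans _ _ (N k0 `^ q * (C * N k0 `^ p))); last by rewrite lerDl.
have Nk : N k <= N k0.
  exact: (@homo_leq _ N (fun x y => x <= y) lexx (@le_trans _ _) N_leS).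
have Np x : 0 <= x -> N k `^ x <= N k0 `^ x.
  by move=> x0; apply: ge0_ler_powR; rewrite ?nnegrE ?(le_trans ler01 (N_ge1 _)).
rewrite ler_pM ?powR_ge0 ?Np// (le_trans (uC k t Ut))// ler_wpM2l// Np//.
Qed.

Let dX_early q : 0 <= q -> exists2 C, 0 <= C &
  forall k t, U t -> t <= mid k -> N k `^ q * `|g k t * X k t + h k t| <= C.
Proof.
move=> q0; have [C [p [C0 p0 gC]]] := Sg 0%N.
have [D D0 XD] := early (addr_ge0 p0 q0).
exists (C * D); first exact: mulr_ge0.
move=> k t Ut tk; rewrite h_eq0// addr0 normrM.
apply: le_trans (ler_wpM2l C0 (XD k t Ut tk)).
rewrite powR_freqD// mulrCA !mulrA ler_wpM2r// ler_wpM2r ?powR_ge0//.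
exact: gC.
Qed.

Let X_in_Cs q t : 0 < q -> t < T -> in_Cs N q (fun k => X k t).
Proof.
move=> q0 tT.
have [C C0 XC] := locally_rapid (ltW q0) tT (SX 0%N) (early (ltW q0)).
by apply/in_CsP; exists C => k; exact: XC.
Qed.

(** Up to a time [t1] strictly between [t] and [T] the time derivative is bounded in the [C^q] norm,
    so [X] is Lipschitz there. *)
Let X_continuous q : 0 < q ->
  continuous_in_Cs N q (time_itv T%:E) (fun t k => X k t).
Proof.
move=> q0; apply/continuous_in_CsP => t [t0 +]; rewrite lte_fin => tT.
split; first exact: X_in_Cs.
move=> eps eps0; pose t1 := (t + T) / 2.
have tt1 : t < t1 by rewrite /t1; lra.
have t1T : t1 < T by rewrite /t1; lra.
have PdX : poly_growth N U (fun k t => g k t * X k t + h k t).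
  exact: (smooth_class_add oU PU (PM (Sg 0%N) (SX 0%N)) (Sgh (SX 0%N)).2).
have [C C0 dC] := locally_rapid (ltW q0) t1T PdX (dX_early (ltW q0)).
pose d := Num.min (t1 - t) (eps / (C + 1)).
have C1 : 0 < C + 1 by rewrite ltr_wpDl.
exists d; first by rewrite lt_min subr_gt0 tt1 divr_gt0.
move=> u _ ud k.
move: (ud); rewrite lt_min => /andP[ud1 ud2].
have ut1 : u <= t1 by move: ud1; rewrite ltr_norml => /andP[_]; lra.
have lip x y : x <= y -> y <= t1 -> N k `^ q * `|X k y - X k x| <= C * (y - x).
  move=> xy yt1; have N0 : 0 <= N k `^ q := powR_ge0 _ _.
  rewrite -[X in X * _]ger0_norm// -normrM mulrBr.
  apply: (@norm_increment_le _ (fun t => N k `^ q * X k t)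
    (fun t => N k `^ q * (g k t * X k t + h k t))) => // w /andP[_ wy].
    have wT : w < T by rewrite (le_lt_trans wy)// (le_lt_trans yt1).
    have dw := dX k wT.
    by have : is_derive w 1 (N k `^ q \*: X k) _ := is_deriveZ (N k `^ q) dw.
  by rewrite normrM ger0_norm// dC// (le_trans wy).
have fin x : x < eps / (C + 1) -> 0 <= x -> C * x <= eps.
  move=> xe x0; apply: (@le_trans _ _ ((C + 1) * x)).
    by rewrite ler_wpM2r// lerDl.
  by rewrite mulrC -ler_pdivlMr// ltW.
have [tu|/ltW ut] := leP t u.
  apply: (le_trans (lip _ _ tu ut1)); apply: fin; last by rewrite subr_ge0.
  by move: ud2; rewrite ger0_norm// subr_ge0.
rewrite distrC; apply: (le_trans (lip _ _ ut (ltW tt1))).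
apply: fin; last by rewrite subr_ge0.
by move: ud2; rewrite distrC ger0_norm// subr_ge0.
Qed.

(** Exactly the terms that the cut-offs remove from the right-hand side: viscosity and gain of mode
    [k], and its loss to mode [k+1]. The factors [-1] keep it a sum of products of symbols. *)
Let f0 (k : nat) (t : R) : R :=
  (1 - chi k t) * (- (nu * N k ^+ 2) * -1 + a k * X k.-1 t * -1) * X k t
  + (1 - chi k.+1 t) * (N k `^ alpha * X k.+1 t) * X k.+1 t.

Let force (t : R) : R^nat := fun k => if t < T then f0 k t else 0.

Let S_f0 n : smooth_class U (rapid_decay N U) n f0.
Proof.
have cut m w := @smooth_class_cutoff R N N_ge1 U m X g h w mid oU dX Sg h_eq0 early.
have cm1 : forall k : nat, `|-1 : R| <= 1 * N k `^ 0.
  by move=> k; rewrite normrN powRr0 mulr1 normr1.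
have Sm1 m := Pcst m ler01 (lexx 0) cm1.
apply: (smooth_class_add oU RU).
  apply: (cut n (fun k t => (1 - chi k t) *
      (- (nu * N k ^+ 2) * -1 + a k * X k.-1 t * -1))).
    move=> m; apply/PM; first exact/S1/Schi.
    apply: (smooth_class_add oU PU); first exact: PM (Sv m) (Sm1 m).
    exact: PM (PM (Sa m) (predP (SX m))) (Sm1 m).
  by move=> k t _ kt; rewrite chi_eq1 ?subrr ?mul0r// ltW.
(* The loss term of mode [k] is a cut-off multiple of [X k.+1], hence the shift by one of a family
   to which the cutting lemma applies; [a k.+1] supplies the power of [N k]. *)
apply: (smooth_class_reindex (u := fun k t => (1 - chi k t) * (a k * X k t) * X k t)
  (phi := fun k => k.+1)).
  by move=> u; exact: rapid_decay_succ.
apply: (cut n (fun k t => (1 - chi k t) * (a k * X k t))).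
  by move=> m; exact: PM (S1 (Schi m)) (PM (Sa m) (SX m)).
by move=> k t _ kt; rewrite chi_eq1 ?subrr ?mul0r// ltW.
Qed.

Let force_smooth D : smooth_in_Cinfty N D force.
Proof.
apply: smooth_in_CinftyP => n.
(* From [mid k.+1] on, both [chi k] and [chi k.+1] are 1 and mode [k] is unforced. *)
apply: (smooth_class_extend (c := mid \o S) _ _ _ _ (S_f0 n)).
- exact: rapid_decay_additive.
- move=> u ru q q0; have [C C0 uC] := ru q q0; exists C => // k t _.
  by case: ifPn => [tT|_]; [exact: uC|rewrite normr0 mulr0].
- by move=> k /=; exact: le_lt_trans (mid_tm _) (tm_ltT _).
- move=> k t /= kt _; rewrite /f0 !chi_eq1 ?subrr ?mul0r ?addr0 ?(ltW kt)//.
  by rewrite (le_trans (mid_tm k))// (le_trans (tm_mid _))// ltW.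
Qed.

Let X_solution :
  obukhov_solution N nu alpha (fun k => X k 0) force T%:E (fun t k => X k t).
Proof.
split; [by []|by move=> q q0; exact: X_continuous|].
move=> t k [t0]; rewrite lte_fin => tT.
have d := dX k tT.
have rhsE : obukhov_rhs N nu alpha (force t) (fun k => X k t) k =
    g k t * X k t + h k t.
  by rewrite /obukhov_rhs /force tT /f0 /g /h /a; case: (k) => [|j] /=; ring.
rewrite rhsE; apply: cvg_within_filter.
have [dt <-] := d.
have := dt; rewrite /derivable => /cvg_ex[l hl].
have -> : 'D_1 (X k) t = l by exact: cvg_lim hl.
move: hl; apply: cvg_trans; apply: near_eq_cvg; near=> w.
by rewrite /= /GRing.scale/= mulr1 (addrC w).
Unshelve. all: by end_near. Qed.

Let peak_at (B t : R) : t < T ->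
  exists2 u, t < u < T & exists k, B < N k `^ s * `|X k u|.
Proof.
move=> tT; have [k1 k1P] := tm_cvg tT; have [k0 k0P] := peak B.
exists (tm (maxn k0 k1).+1).
  by rewrite tm_ltT k1P// (leq_trans (leq_maxr k0 k1)).
exists (maxn k0 k1); rewrite ger0_norm; last exact: ltW.
by apply: k0P; exact: leq_maxl.
Qed.

Let T_gt0 : 0 < T := le_lt_trans (tm_ge0 0%N) (tm_ltT 0%N).

Let X_unbounded :
  ereal_sup [set wnorm N s (X^~ t) | t in time_itv T%:E] = +oo%E.
Proof.
apply/eqP; rewrite -leye_eq leNgt; apply/negP => supoo.
set S := ereal_sup _ in supoo.
have wS t : 0 <= t -> t < T -> (wnorm N s (X^~ t) <= S)%E.
  by move=> t0 tT; apply: ereal_sup_ubound; exists t => //; split => //; rewrite lte_fin.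
have S0 : (0 <= S)%E by apply: le_trans (wS 0 (lexx _) T_gt0); exact: wnorm_ge0.
have Sfin : S = (fine S)%:E by rewrite fineK// ge0_fin_numE.
have [u /andP[u0 uT] [k]] := peak_at (fine S) T_gt0.
rewrite ltNge => /negP; apply; rewrite -lee_fin -Sfin.
exact: le_trans (le_wnorm N s (X^~ u) k) (wS u (ltW u0) uT).
Qed.

(** Maximality: a solution defined at [T] coincides with [X] before [T] by uniqueness, and its
    continuity at [T] in [C^s] bounds the norm near [T], against the peaks. *)
Lemma blowup_from_profile : exists f : R -> R^nat,
  [/\ in_Cinfty N (X^~ 0), smooth_in_Cinfty N (time_itv +oo%E) f,
      maximal_obukhov_solution N nu alpha (X^~ 0) f T%:E (fun t => X^~ t) &
      ereal_sup [set wnorm N s (X^~ t) | t in time_itv T%:E] = +oo%E].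
Proof.
exists force; split; [by move=> q q0; exact: X_in_Cs|exact: force_smooth| |exact: X_unbounded].
split; [by rewrite lte_fin|exact: X_solution|].
move=> T' Y sY.
have YX t : time_itv T' t -> t < T -> Y t = X^~ t.
  move=> T't tT; apply: (obukhov_unique N_ge1 N_leS nu_ge0 alpha_gt0 sY X_solution T't).
  by case: T't => t0 _; split => //; rewrite lte_fin.
have T'T : (T' <= T%:E)%E.
  rewrite leNgt; apply/negP => TT'.
  have T'T : time_itv T' T by split => //; exact: ltW.
  have [_ Yc _] := sY.
  have [/in_CsP[B YB] hY] := (iffLR (continuous_in_CsP _ _ _ _) (Yc _ s_gt0)) T T'T.
  have [d d0 dP] := hY 1 ltr01.
  pose t := Num.max 0 (T - d).
  have tT : t < T by rewrite gt_max T_gt0/= gtrBl.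
  have [u /andP[tu uT] [k]] := peak_at (B + 1) tT.
  have u0 : 0 <= u by rewrite (le_trans _ (ltW tu))// le_max lexx.
  have T'u : time_itv T' u by apply: time_itv_le T'T u0 (ltW uT).
  have uTd : `|u - T| < d.
    rewrite ltr0_norm ?subr_lt0// opprB.
    have : T - d <= t by rewrite le_max lexx orbT.
    lra.
  have := dP u T'u uTd k; have := YB k; rewrite (YX u T'u uT) => h1 h2.
  apply/negP; rewrite -leNgt.
  rewrite -[X k u](subrK (Y T k)).
  rewrite (le_trans (ler_wpM2l (powR_ge0 _ _) (ler_normD _ _)))//.
  by rewrite mulrDr addrC lerD.
split=> // t T't; apply: YX => //; case: (T't) => _ tT'.
by rewrite -lte_fin; exact: lt_le_trans T'T.
Qed.

End blowup.

(** * Choice of the scales *)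

Section construction.
Context {R : realType}.
Variables (N : R^nat) (b nu alpha sg dl s : R).
Local Notation e := (expR (1 : R)).
Local Notation beta := (alpha - sg).
Hypotheses (N_ge1 : forall k, 1 <= N k) (N_leS : forall k, N k <= N k.+1)
  (N_S : forall k, N k.+1 = N k `^ b) (b_gt1 : 1 < b) (nu_gt0 : 0 < nu)
  (alpha_gt0 : 0 < alpha) (s_gt0 : 0 < s)
  (sg_gt0 : 0 < sg) (dl_gt0 : 0 < dl) (dl_lt : dl < beta)
  (loss_exp : forall k, 12 * e ^+ 2 * N k `^ (dl - sg * (b - 1)) <= 1)
  (gain_exp : forall k, 6 * e * N k `^ (beta - b * (beta - dl)) <= 1)
  (visc_exp : forall k, 6 * nu * N k `^ (2 - (beta - dl)) <= 1)
  (growth_exp : forall k, 2 * nu * e * N k `^ (2 * b - beta) <= 1)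
  (time_exp : forall k, 2 * N k `^ ((dl - beta) * (b - 1)) <= 1)
  (peak_exp : forall B, exists k0, forall k, (k0 <= k)%N -> B < N k `^ (s - sg)).

(** Growth time of mode [k]: its rate being of order [N k.-1] to the power [beta], its logarithm
    gains over this time an amount of order [N k.-1] to the power [dl]. By the convention on [k.-1],
    [d 0] equals [d 1]. *)
Let d (k : nat) : R := N k.-1 `^ (dl - beta).
Let tm (k : nat) : R := \sum_(i < k) d i.
Let mid (k : nat) : R := tm k + d k / 2.
Let T : R := sup (range tm).
Let A (k : nat) : R := N k `^ (- sg).
Let a (k : nat) : R := if k is j.+1 then N j `^ alpha else 0.
Let r (k : nat) : R := a k * A k.-1.
Let v (k : nat) : R := nu * N k ^+ 2.
Let p (k : nat) : R := N k `^ alpha * A k.+1 ^+ 2 / A k.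
Let L (k : nat) : R := 2 * N k `^ dl.
(** Weights growing like the product of the integrated gains, which [L] bounds, so that [gain] is
    the recursion itself. *)
Let M (k : nat) : R := iteri k (fun j m => 4 * e * L j * m) 1.

Let Ngt0 k : 0 < N k. Proof. exact: lt_le_trans (N_ge1 k). Qed.
Let e_ge1 : 1 <= e. Proof. by rewrite -(expR0 R) ler_expR. Qed.
Let e_gt0 : 0 < e. Proof. exact: expR_gt0. Qed.
Let d_gt0 k : 0 < d k. Proof. exact: powR_gt0. Qed.
Let A_gt0 k : 0 < A k. Proof. exact: powR_gt0. Qed.
Let A_le1 k : A k <= 1.
Proof. by rewrite -(powRr0 (N k)) ler_powR// oppr_le0 ltW. Qed.
Let tmS k : tm k.+1 = tm k + d k. Proof. exact: big_ord_recr. Qed.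
Let tm_ge0 k : 0 <= tm k. Proof. by apply: sumr_ge0 => i _; exact: ltW. Qed.
Let tm_ltS k : tm k < tm k.+1. Proof. by rewrite tmS ltrDl. Qed.
Let tm_le j k : (j <= k)%N -> tm j <= tm k.
Proof.
by apply: (@homo_leq _ tm (fun x y => x <= y) lexx (@le_trans _ _)) => i; exact: ltW.
Qed.

Let d_half k : 2 * d k.+2 <= d k.+1.
Proof.
rewrite /d/= N_S -powRrM (_ : b * (dl - beta) = (dl - beta) * (b - 1) + (dl - beta));
  last by ring.
by rewrite (powR_freqD N_ge1 k ((dl - beta) * (b - 1))) mulrA ler_piMl// powR_ge0.
Qed.

Let tm_tail k j : tm j <= tm k.+1 + 2 * d k.+1.
Proof.
have [jk|kj] := leqP j k.+1.
  by rewrite (le_trans (tm_le jk))// lerDl mulr_ge0// ltW.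
rewrite -(subnKC (ltnW kj)); move: (j - k.+1)%N => n.
(* [tm + 2 d] is nonincreasing from index 1 on, where the growth times at least halve at each
   step. *)
suff : tm (k.+1 + n)%N + 2 * d (k.+1 + n)%N <= tm k.+1 + 2 * d k.+1.
  by apply: le_trans; rewrite lerDl mulr_ge0// ltW.
elim: n => [|n IH]; first by rewrite addn0.
apply: le_trans IH; rewrite addnS tmS addSn.
by have := d_half (k + n); set x := d _; set y := d _; set z := tm _; lra.
Qed.

Let T_sup : has_sup (range tm).
Proof.
split; first by exists (tm 0%N), 0%N.
by exists (tm 1%N + 2 * d 1%N) => _ [j _ <-]; exact: tm_tail.
Qed.

Let tm_ltT k : tm k < T.
Proof.
by apply: lt_le_trans (tm_ltS k) _; apply: sup_upper_bound => //; exists k.+1.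
Qed.

Let tm_cvg t : t < T -> exists k0, forall k, (k0 <= k)%N -> t < tm k.
Proof.
move=> tT; have Tt : 0 < T - t by rewrite subr_gt0.
have [_ [k0 _ <-]] := sup_adherent Tt T_sup; rewrite -/T opprB addrC subrK => h.
by exists k0 => k kk; apply: lt_le_trans h (tm_le kk).
Qed.

Let T_tail k : T - tm k.+1 <= 2 * N k `^ (dl - beta).
Proof.
by rewrite lerBlDl; apply: ge_sup; [exists (tm 0%N), 0%N|move=> _ [j _ <-]; exact: tm_tail].
Qed.

Let rS k : r k.+1 = N k `^ beta.
Proof. by rewrite /r /a /A/= powR_freqD. Qed.

Let NA k : N k `^ alpha * A k = N k `^ beta. Proof. exact: rS. Qed.

Let r_ge0 k : 0 <= r k.
Proof. by case: k => [|k]; rewrite ?rS ?powR_ge0// /r /a mul0r. Qed.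

Let v_ge0 k : 0 <= v k. Proof. by rewrite mulr_ge0// ltW// exprn_gt0. Qed.

Let p_ge0 k : 0 <= p k.
Proof. by rewrite !mulr_ge0 ?powR_ge0// ?invr_ge0 ?exprn_ge0 ?powR_ge0. Qed.

Let rho (k : nat) : R := A k.+1 / A k.

Let rho_gt0 k : 0 < rho k. Proof. exact: divr_gt0. Qed.

Let pE k : p k = N k `^ beta * rho k ^+ 2.
Proof. by rewrite -NA /p /rho; field; rewrite gt_eqF. Qed.

Let L_ge k : 2 <= L k.
Proof. by rewrite /L ler_peMr//; apply: powR_freq_ge1 => //; exact: ltW. Qed.

Let L_ge0 k : 0 <= L k. Proof. exact: le_trans (L_ge k). Qed.

Let tail_gain k : (T - tm k.+1) * N k `^ beta <= L k.
Proof.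
apply: (le_trans (ler_wpM2r (powR_ge0 _ _) (T_tail k))).
by rewrite -mulrA -powR_freqD// subrK.
Qed.

Let L_rho k : 6 * e ^+ 2 * (L k * rho k) <= 1.
Proof.
apply: le_trans (loss_exp k); rewrite /L /rho /A N_S -powRrM -powRN opprK.
have -> : 6 * e ^+ 2 * (2 * N k `^ dl * (N k `^ (b * - sg) * N k `^ sg)) =
   12 * e ^+ 2 * (N k `^ dl * (N k `^ (b * - sg) * N k `^ sg)) by ring.
rewrite -!powR_freqD// (_ : dl + (b * - sg + sg) = dl - sg * (b - 1))//; ring.
Qed.

(** The integrated loss is at most [L k * rho k ^+ 2]. The extra factor [L k] compensates the ratio
    of consecutive weights in [loss]; it is affordable because [loss_exp] makes [L k * rho k]
    small. *)
Let tail_loss k : 36 * e ^+ 4 * L k * ((T - tm k.+1) * p k) <= 1.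
Proof.
apply: (@le_trans _ _ ((6 * e ^+ 2 * (L k * rho k)) ^+ 2)); last first.
  apply: exprn_ile1 => //; apply: mulr_ge0; last exact: mulr_ge0 (L_ge0 k) (ltW (rho_gt0 k)).
  by rewrite mulr_ge0// exprn_ge0// ltW.
rewrite pE.
have -> : (6 * e ^+ 2 * (L k * rho k)) ^+ 2 =
  36 * e ^+ 4 * L k * (rho k ^+ 2 * L k) by ring.
apply: ler_wpM2l; first by rewrite mulr_ge0// mulr_ge0// exprn_ge0// ltW.
rewrite mulrA mulrC; apply: ler_wpM2l => //.
by rewrite exprn_ge0// ltW.
Qed.

Let tail_p_le k : 3 * ((T - tm k.+1) * (p k * e ^+ 3)) <= 1.
Proof.
apply: le_trans (tail_loss k).
set x := (T - tm k.+1) * p k.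
have x0 : 0 <= x by rewrite mulr_ge0// subr_ge0 ltW.
have -> : 3 * ((T - tm k.+1) * (p k * e ^+ 3)) = 3 * e ^+ 3 * x by rewrite /x; ring.
rewrite ler_wpM2r//.
have e3 : 0 <= e ^+ 3 by rewrite exprn_ge0// ltW.
have : e ^+ 3 * 1 <= e ^+ 3 * (e * L k).
  by rewrite ler_wpM2l//; have := L_ge k; have := e_ge1; nra.
have -> : 36 * e ^+ 4 * L k = 36 * (e ^+ 3 * (e * L k)) by ring.
lra.
Qed.

Let MS k : M k.+1 = 4 * e * L k * M k. Proof. by []. Qed.

Let M_gt0 k : 0 < M k.
Proof.
elim: k => [|k IH]; first by rewrite /M.
rewrite MS; apply: mulr_gt0 => //; apply: mulr_gt0; first exact: mulr_gt0.
exact: lt_le_trans (L_ge k).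
Qed.

Let gain k : 4 * ((T - tm k) * (r k * e * M k.-1)) <= M k.
Proof.
case: k => [|k]; first by rewrite /r /a !mul0r !mulr0 ltW.
rewrite rS MS/=.
have := ler_wpM2r (ltW (mulr_gt0 e_gt0 (M_gt0 k))) (tail_gain k).
set x := T - _; set y := _ `^ _; lra.
Qed.

Let loss k : 4 * ((T - tm k.+1) * (p k * e ^+ 3 * (2 * M k.+1 + M k))) <= M k.
Proof.
set x := (T - tm k.+1) * p k.
have x0 : 0 <= x by rewrite mulr_ge0// subr_ge0 ltW.
have -> : 4 * ((T - tm k.+1) * (p k * e ^+ 3 * (2 * M k.+1 + M k))) =
  4 * e ^+ 3 * (8 * (e * L k) + 1) * x * M k by rewrite MS /x; ring.
rewrite ler_piMl ?(ltW (M_gt0 k))//.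
apply: le_trans (tail_loss k); rewrite ler_wpM2r//.
have eL : 1 <= e * L k by have := L_ge k; have := e_ge1; nra.
have -> : 36 * e ^+ 4 * L k = 4 * e ^+ 3 * (9 * (e * L k)) by ring.
by rewrite ler_wpM2l ?mulr_ge0 ?exprn_ge0 ?(ltW e_gt0)//; lra.
Qed.

Let gain_loss k : 2 * v k.+1 <= r k.+1 / e.
Proof.
rewrite ler_pdivlMr// rS /v N_S -powR_mulrn ?powR_ge0// -powRrM.
have -> : 2 * (nu * N k `^ (b * 2)) * e = 2 * nu * e * N k `^ (2 * b - beta + beta).
  by rewrite subrK (mulrC b); ring.
by rewrite (powR_freqD N_ge1 k (2 * b - beta)) mulrA ler_piMl// powR_ge0.
Qed.

(** Viscosity uses one third of the budget in [late]; [tail_r] and [tail_p_le] use the other two. *)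
Let tail_v k : 3 * ((T - tm k.+1) * v k) <= 1.
Proof.
apply: le_trans (visc_exp k).
have := ler_wpM2r (v_ge0 k) (T_tail k); rewrite /v => h.
have -> : 6 * nu * N k `^ (2 - (beta - dl)) =
  3 * (2 * N k `^ (dl - beta) * (nu * N k ^+ 2)).
  rewrite -powR_mulrn ?(ltW (Ngt0 k))//.
  rewrite (_ : 2 - (beta - dl) = 2 + (dl - beta)); last by ring.
  by rewrite (powR_freqD N_ge1 k 2); ring.
by rewrite ler_wpM2l.
Qed.

Let tail_r k : 3 * ((T - tm k.+1) * (r k * e)) <= 1.
Proof.
case: k => [|k]; first by rewrite /r /a !mul0r !mulr0.
rewrite rS; apply: le_trans (gain_exp k).
have := ler_wpM2r (mulr_ge0 (powR_ge0 (N k) beta) (ltW e_gt0)) (T_tail k.+1) => h.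
have -> : 6 * e * N k `^ (beta - b * (beta - dl)) =
  3 * (2 * N k.+1 `^ (dl - beta) * (N k `^ beta * e)).
  rewrite (_ : beta - b * (beta - dl) = beta + b * (dl - beta)); last by ring.
  by rewrite (powR_freqD N_ge1 k beta) N_S -powRrM; ring.
by rewrite ler_wpM2l.
Qed.

Let late k : (T - tm k.+1) * (r k * e + v k + p k * e ^+ 3) <= 1.
Proof.
have := tail_v k; have := tail_r k; have := tail_p_le k.
set x := T - _; rewrite !mulrDr; lra.
Qed.

Let v0_le : tm 1%N * v 0%N <= 1.
Proof.
have -> : tm 1%N = d 0%N by rewrite /tm big_ord1.
apply: le_trans (visc_exp 0); rewrite /v /d/= -powR_mulrn ?(ltW (Ngt0 0))//.
rewrite mulrCA -powR_freqD// (_ : dl - beta + 2 = 2 - (beta - dl)); last by ring.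
by rewrite ler_wpM2r ?powR_ge0//; have := nu_gt0; lra.
Qed.

(** [T * v 0%N] pays for the viscosity of mode 0, which has no gain. In higher modes viscosity is
    below [r k * e], which the weights control, and the loss is at most one third. *)
Let first_step : let C := 2 + T * v 0%N in forall k,
  (T - tm k) * (r k * e + v k) + (T - tm k.+1) * (p k * e ^+ 3) <= C * M k.
Proof.
move=> C k; have T0 : 0 <= T := le_trans (tm_ge0 0%N) (ltW (tm_ltT 0%N)).
have pk := tail_p_le k.
case: k pk => [|k] pk.
  have -> : M 0%N = 1 by [].
  have -> : tm 0%N = 0 by rewrite /tm big_ord0.
  by rewrite /C /r /a !mul0r add0r subr0 mulr1; lra.
have Tv : 0 <= T * v 0%N by rewrite mulr_ge0.
have M1 j : 1 <= M j.
  elim: j => [|j IH]; first by [].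
  rewrite MS; have eL : 1 <= e * L j by have := L_ge j; have := e_ge1; nra.
  by have := e_ge1; rewrite -mulrA -[leLHS]mulr1; nra.
apply: (@le_trans _ _ (2 * M k.+1)); last first.
  by rewrite ler_wpM2r ?(ltW (M_gt0 _))// /C; lra.
suff : (T - tm k.+1) * (r k.+1 * e + v k.+1) <= M k.+1 by have := M1 k.+1; lra.
have vr : v k.+1 <= r k.+1 * e.
  have h1 := gain_loss k; have h2 := v_ge0 k.+1.
  have : r k.+1 / e <= r k.+1 * e.
    rewrite ler_wpM2l// (@le_trans _ _ 1)// invf_le1//.
  lra.
have h := ler_wpM2r (ltW e_gt0) (tail_gain k); rewrite -rS in h.
have M1k := M1 k; rewrite MS.
have x0 : 0 <= T - tm k.+1 by rewrite subr_ge0 ltW.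
have := ler_wpM2l x0 vr.
have : 4 * e * L k * 1 <= 4 * e * L k * M k.
  by rewrite ler_wpM2l// !mulr_ge0 ?(ltW e_gt0)// powR_ge0.
have : 0 <= e * L k by rewrite mulr_ge0 ?(ltW e_gt0)// mulr_ge0 ?powR_ge0.
move: h; set x := T - _; rewrite mulrDr; lra.
Qed.

Let tm_mid k : tm k <= mid k.
Proof. by rewrite /mid lerDl divr_ge0// ltW. Qed.

Let mid_tm k : mid k <= tm k.+1.
Proof. by rewrite /mid tmS lerD2l; have := d_gt0 k; lra. Qed.

Lemma blowup_construction : exists (X0 : R^nat) (f : R -> R^nat),
  [/\ in_Cinfty N X0, forall k, 0 < X0 k,
      smooth_in_Cinfty N (time_itv +oo%E) f &
      exists (Tstar : \bar R) (X : R -> R^nat),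
        [/\ maximal_obukhov_solution N nu alpha X0 f Tstar X,
            (Tstar < +oo)%E &
            ereal_sup [set wnorm N s (X t) | t in time_itv Tstar] = +oo%E]].
Proof.
have [psi [psi01 psi0 psi1 Spsi]] := @smooth_step_exists R.
(* The step rescaled to start at [tm k] and to be 1 from [mid k] on, in the affine form of
   [smooth_class_affine]. *)
pose chi k t := psi ((d k)^-1 * t + - (tm k / d k)).
have chiE k t : (d k)^-1 * t + - (tm k / d k) = (t - tm k) / d k.
  by rewrite mulrBl mulrC.
have chi_ge0 k t : 0 <= chi k t by have /andP[] := psi01 ((d k)^-1 * t + - (tm k / d k)).
have chi_le1 k t : chi k t <= 1 by have /andP[] := psi01 ((d k)^-1 * t + - (tm k / d k)).
have chi_eq0 k t : t <= tm k -> chi k t = 0.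
  by move=> tk; apply: psi0; rewrite chiE pmulr_lle0 ?invr_gt0// subr_le0.
have chi_eq1 k t : mid k <= t -> chi k t = 1.
  by move=> kt; apply: psi1; rewrite chiE ler_pdivlMr// mulrC lerBrDl.
have Schi V n : open V -> smooth_class V (poly_growth N V) n chi.
  move=> oV; apply: (smooth_class_affine N_ge1 (u := fun=> psi)
    (fun k => - (tm k / d k)) oV _ (Spsi N n N_ge1)).
  (* The slope is the inverse of [d k], a power of [N k.-1] with positive exponent [beta - dl]. *)
  apply: (@poly_growth_pred _ _ N_ge1 N_leS V (fun k _ => (N k `^ (dl - beta))^-1)).
  apply: (@poly_growth_cst _ _ _ _ 1 (beta - dl)) => //.
    by rewrite subr_ge0 ltW.
  by move=> k; rewrite mul1r -powRN opprB ger0_norm// powR_ge0.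
have chi_cont k : continuous (chi k).
  move=> t; have S1 := Schi setT 1%N openT.
  exact: is_derive_continuous (smooth_class_is_derive k S1 (I : setT t)).
have [z [_ zP]] := cascade_exists tm_ge0 tm_ltS tm_ltT chi_cont chi_ge0 chi_le1
  chi_eq0 r_ge0 v_ge0 p_ge0 M_gt0 gain loss first_step.
have r0 : r 0%N = 0 by rewrite /r mul0r.
have z_le1 := profile_le1 tm_ge0 tm_ltS tm_ltT chi_ge0 chi_le1 chi_eq0 r0 r_ge0
  v_ge0 p_ge0 late v0_le gain_loss zP.
have z_early := profile_early tm_ltT tm_mid mid_tm chi_ge0 chi_le1 chi_eq0 chi_eq1
  r_ge0 v_ge0 p_ge0 late gain_loss zP.
have z_peak := profile_peak tm_ltT zP.
have z_derive := profile_derive tm_ge0 tm_ltS tm_ltT chi_ge0 chi_le1 chi_eq0 r0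
  r_ge0 v_ge0 p_ge0 late v0_le gain_loss zP.
pose X k t := A k * expR (z k t).
have X_gt0 k t : 0 < X k t by rewrite mulr_gt0// expR_gt0.
have X_le k t : X k t <= e.
  by rewrite -[leRHS]mul1r ler_pM ?expR_ge0 ?(ltW (A_gt0 _)) ?ler_expR.
have dX k (t : R) : t < T -> is_derive t 1 (X k)
    (chi k t * (a k * X k.-1 t - nu * N k ^+ 2) * X k t +
     - (chi k.+1 t * (N k `^ alpha * X k.+1 t ^+ 2))).
  move=> tT; have dz := z_derive k t tT.
  have dE := is_derive1_comp (is_derive_expR (z k t)) dz.
  have dA : is_derive t 1 (A k \*: (expR \o z k)) _ := is_deriveZ (A k) dE.
  apply: is_derive_eq dA _; rewrite /GRing.scale/= /X /r /v /p expRN.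
  by field; rewrite !gt_eqF ?expR_gt0.
have early q : 0 <= q -> exists2 C, 0 <= C &
     forall k t, [set t | t < T] t -> t <= mid k -> N k `^ q * `|X k t| <= C.
  (* With [b * q <= m * dl], the weight of mode [k+1] is at most a constant times [y ^+ m], which
     [expR (- y)] absorbs at the cost of [m] factorial. *)
  move=> q0; pose m := Num.bound (b * q / dl).
  have bq0 : 0 <= b * q by rewrite mulr_ge0// (le_trans _ (ltW b_gt1)).
  have bqm : b * q <= m%:R * dl.
    by rewrite -ler_pdivrMr// ltW// archi_boundP// divr_ge0// ltW.
  exists (N 0%N `^ q * e + (4 * e) ^+ m * m`!%:R).
    by rewrite addr_ge0 ?mulr_ge0 ?powR_ge0 ?exprn_ge0 ?mulr_ge0 ?(ltW e_gt0).
  (* Mode 0 has no growth phase; a constant bounds this single mode. *)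
  case=> [|k] t _ tk; rewrite ger0_norm ?(ltW (X_gt0 _ _))//.
    apply: (@le_trans _ _ (N 0%N `^ q * e)); first by rewrite ler_wpM2l ?powR_ge0.
    by rewrite lerDl mulr_ge0// exprn_ge0// mulr_ge0// ltW.
  apply: (@le_trans _ _ ((4 * e) ^+ m * m`!%:R)); last first.
    by rewrite lerDr mulr_ge0 ?powR_ge0// ltW.
  pose y := N k `^ dl / (4 * e).
  have y0 : 0 <= y by rewrite divr_ge0 ?powR_ge0// mulr_ge0// ltW.
  (* Half the growth time, [d k.+1 / 2], times the rate [r k.+1 / (2 * e)] is [y]. *)
  have zy : z k.+1 t <= - y.
    apply: le_trans (z_early k t tk) _; rewrite lerN2 le_eqVlt; apply/orP; left.
    apply/eqP; rewrite /y /mid tmS rS.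
    have -> : N k `^ dl = d k.+1 * N k `^ beta.
      by rewrite /d/= -powR_freqD// subrK.
    by field; rewrite gt_eqF.
  have Xy : X k.+1 t <= expR (- y).
    by rewrite -[leRHS]mul1r ler_pM ?expR_ge0 ?(ltW (A_gt0 _)) ?ler_expR.
  have Nq : N k.+1 `^ q <= (4 * e) ^+ m * y ^+ m.
    rewrite N_S -powRrM -exprMn /y (mulrC (4 * e)) divfK; last first.
      by rewrite mulf_neq0// gt_eqF.
    rewrite -powR_mulrn ?powR_ge0// -powRrM ler_powR// (mulrC dl).
    exact: bqm.
  apply: (@le_trans _ _ ((4 * e) ^+ m * y ^+ m * expR (- y))).
    by rewrite ler_pM ?powR_ge0 ?(ltW (X_gt0 _ _)).
  have e4 : 0 <= (4 * e) ^+ m by rewrite exprn_ge0// mulr_ge0// ltW.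
  by rewrite -(mulrA ((4 * e) ^+ m)); apply: (ler_wpM2l e4); exact: pow_expRN_le.
have peak B : exists k0, forall k, (k0 <= k)%N -> B < N k `^ s * X k (tm k.+1).
  have [k0 k0P] := peak_exp B; exists k0 => k /k0P.
  by rewrite /X z_peak expR0 mulr1 /A -powR_freqD.
have b_ge0 : 0 <= b by rewrite (le_trans _ (ltW b_gt1)).
have N_geS k : N k.+1 <= N k `^ b by rewrite N_S.
have [f [X0 Sf maxX supX]] := blowup_from_profile N_ge1 b_ge0 N_leS N_geS (ltW nu_gt0)
  alpha_gt0 s_gt0 tm_ge0 tm_ltT tm_cvg tm_mid mid_tm chi_eq0 chi_eq1
  (fun n => Schi _ n (@open_lt _ T)) X_gt0 X_le dX early peak.
exists (X^~ 0), f; split => //.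
by exists T%:E, (fun t => X^~ t); split => //; rewrite ltry.
Qed.

End construction.

(** One threshold serves every larger base and every exponent below [- gam], hence all modes and all
    smallness conditions at once. The 2 in [2 + K] makes it exceed 1. *)
Lemma exists_powR_small (R : realType) (K gam : R) : 0 <= K -> 0 < gam ->
  exists2 N0 : R, 1 < N0 & forall x y, N0 <= x -> y <= - gam -> K * x `^ y <= 1.
Proof.
move=> K0 gam0; exists ((2 + K) `^ gam^-1).
  have : 1 `^ gam^-1 < (2 + K) `^ gam^-1.
    by apply: gt0_ltr_powR; rewrite ?invr_gt0 ?nnegrE//; lra.
  by rewrite powR1.
move=> x y Nx ygam; have K2 : 0 < 2 + K by lra.
have N1 : 1 <= (2 + K) `^ gam^-1.
  by rewrite -[leLHS](powRr0 (2 + K)) ler_powR ?invr_ge0 ?(ltW gam0)//; lra.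
have x1 : 1 <= x := le_trans N1 Nx.
apply: (@le_trans _ _ (K * x `^ (- gam))); first by rewrite ler_wpM2l// ler_powR.
have hx : 2 + K <= x `^ gam.
  have -> : 2 + K = ((2 + K) `^ gam^-1) `^ gam.
    by rewrite -powRrM mulVf ?gt_eqF// powRr1// ltW.
  by apply: ge0_ler_powR; rewrite ?nnegrE ?powR_ge0 ?(ltW gam0) ?(le_trans ler01 x1).
have xg : 0 < x `^ gam by apply: powR_gt0; apply: lt_le_trans x1.
by rewrite powRN ler_pdivrMr// mul1r; lra.
Qed.

(** * The frequency scales *)

Section frequencies.
Context {R : realType}.
Variables (N0 b : R).
Hypotheses (N0_gt1 : 1 < N0) (b_gt1 : 1 < b).

Lemma freqS k : freq N0 b k.+1 = freq N0 b k `^ b.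
Proof. by rewrite /freq exprSr powRrM. Qed.

Lemma freq_geN0 k : N0 <= freq N0 b k.
Proof.
rewrite -[leLHS]powRr1 ?(le_trans ler01 (ltW N0_gt1))//.
by rewrite ler_powR ?(ltW N0_gt1)// exprn_ege1// ltW.
Qed.

Lemma freq_ge1 k : 1 <= freq N0 b k.
Proof. exact: le_trans (ltW N0_gt1) (freq_geN0 k). Qed.

Lemma freq_leS k : freq N0 b k <= freq N0 b k.+1.
Proof.
by rewrite freqS -[leLHS]powRr1 ?(le_trans ler01 (freq_ge1 k))// ler_powR ?freq_ge1// ltW.
Qed.

Lemma freq_powR_unbounded p : 0 < p -> forall B : R,
  exists k0, forall k, (k0 <= k)%N -> B < freq N0 b k `^ p.
Proof.
move=> p0 B.
(* Bernoulli's inequality, followed by [1 + x <= expR x], gives at least linear growth in [k]. *)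
have bern k : 1 + k%:R * (b - 1) <= b ^+ k.
  elim: k => [|k IH]; first by rewrite mul0r addr0 expr0.
  rewrite exprS -natr1; have b1 : 0 <= b - 1 by rewrite subr_ge0 ltW.
  have h1 : 0 <= k%:R * (b - 1) * (b - 1) by rewrite !mulr_ge0.
  have h2 : 0 <= b * (b ^+ k - (1 + k%:R * (b - 1))).
    by rewrite mulr_ge0 ?subr_ge0// (le_trans ler01 (ltW b_gt1)).
  rewrite -subr_ge0 (_ : _ - _ = b * (b ^+ k - (1 + k%:R * (b - 1))) +
    k%:R * (b - 1) * (b - 1)); last by ring.
  exact: addr_ge0.
have lnN0 : 0 < ln N0 by rewrite ln_gt0.
pose c := p * ln N0 * (b - 1).
have c0 : 0 < c by rewrite !mulr_gt0// subr_gt0.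
exists (Num.bound (`|B| / c)) => k kk.
have Bk : `|B| < k%:R * c.
  rewrite -ltr_pdivrMr//; apply: lt_le_trans (archi_boundP _) _.
    by rewrite divr_ge0// ltW.
  by rewrite ler_nat.
apply: (le_lt_trans (ler_norm B)); apply: (lt_le_trans Bk).
rewrite /freq -powRrM /powR gt_eqF; last exact: lt_trans N0_gt1.
apply: le_trans (expR_ge1Dx _).
have := ler_wpM2r (mulr_ge0 (ltW p0) (ltW lnN0)) (bern k).
have : 0 <= p * ln N0 by rewrite mulr_ge0// ltW.
rewrite /c.
have -> : b ^+ k * p * ln N0 = b ^+ k * (p * ln N0) by ring.
lra.
Qed.

End frequencies.

Theorem theorem1p3 (R : realType) (nu alpha : R) (nu_gt0 : 0 < nu)
    (alpha_gt2 : 2 < alpha) (s : R) (s_gt0 : 0 < s) :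
  exists N0 b : R, [/\ 1 < N0, 1 < b &
    exists (X0 : R^nat) (f : R -> R^nat),
      [/\ in_Cinfty (freq N0 b) X0,
          forall k, 0 < X0 k,
          smooth_in_Cinfty (freq N0 b) (time_itv +oo%E) f &
          exists (Tstar : \bar R) (X : R -> R^nat),
            [/\ maximal_obukhov_solution (freq N0 b) nu alpha X0 f Tstar X,
                (Tstar < +oo)%E &
                ereal_sup [set wnorm (freq N0 b) s (X t) | t in time_itv Tstar]
                  = +oo%E]]].
Proof.
(* [sg < s] makes the peaks unbounded in [C^s], and [sg] at most half of [alpha - 2] keeps
   [beta > 2]. *)
pose sg := Num.min s (alpha - 2) / 2.
have m0 : 0 < Num.min s (alpha - 2) by rewrite lt_min s_gt0 subr_gt0.
have sg_gt0 : 0 < sg by rewrite divr_gt0.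
have sg_s : sg < s.
  have : Num.min s (alpha - 2) <= s by rewrite ge_min lexx.
  by rewrite /sg; lra.
have sg_alpha : 2 * sg <= alpha - 2.
  have : Num.min s (alpha - 2) <= alpha - 2 by rewrite ge_min lexx orbT.
  by rewrite /sg; lra.
pose beta := alpha - sg; have beta2 : 2 < beta by rewrite /beta; lra.
(* The midpoint of 1 and [beta / 2]: growth beats viscosity as soon as [2 * b < beta]. *)
pose b := 2^-1 + beta / 4.
have b1 : 1 < b by rewrite /b; lra.
have b2 : 2 * b < beta by rewrite /b; lra.
(* The three terms are the upper limits on [dl] that make the loss, gain and viscosity exponents
   negative; [dl] is half their minimum. *)
pose w := Num.min (Num.min (sg * (b - 1)) (beta * (b - 1) / b)) (beta - 2).
have b0 : 0 < b by lra.
have w0 : 0 < w.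
  by rewrite !lt_min !mulr_gt0 ?invr_gt0 ?subr_gt0//; lra.
pose dl := w / 2; have dl0 : 0 < dl by rewrite divr_gt0.
have w1 : w <= sg * (b - 1) by rewrite /w !ge_min lexx.
have w2 : w * b <= beta * (b - 1).
  by rewrite -ler_pdivlMr// /w !ge_min lexx !orbT.
have w3 : w <= beta - 2 by rewrite /w !ge_min lexx !orbT.
have dlE : 2 * dl = w by rewrite /dl; lra.
(* A common margin: all five exponents are at most [- gam]. *)
pose gam := Num.min (Num.min (Num.min dl (b * dl)) (beta - 2 * b)) ((beta - dl) * (b - 1)).
have gam0 : 0 < gam.
  by rewrite !lt_min dl0 !mulr_gt0 ?subr_gt0//; lra.
have g1 : gam <= dl by rewrite /gam !ge_min lexx.
have g2 : gam <= b * dl by rewrite /gam !ge_min lexx !orbT.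
have g3 : gam <= beta - 2 * b by rewrite /gam !ge_min lexx !orbT.
have g4 : gam <= (beta - dl) * (b - 1) by rewrite /gam !ge_min lexx !orbT.
pose e := expR (1 : R).
have e1 : 1 <= e by rewrite -(expR0 R) ler_expR.
(* Majorises the constants [12 * e ^+ 2], [6 * e], [6 * nu], [2 * nu * e] and 2 of the five
   conditions. *)
pose K := 12 * e ^+ 2 * (1 + nu).
have ee : e <= e ^+ 2 by rewrite expr2; nra.
have K0 : 0 <= K by rewrite /K; nra.
have [N0 N0_gt1 N0P] := exists_powR_small K0 gam0.
exists N0, b; split => //.
have small c y k : 0 <= c -> c <= K -> y <= - gam -> c * freq N0 b k `^ y <= 1.
  move=> c0 cK yg; apply: le_trans (N0P _ y (freq_geN0 N0_gt1 b1 k) yg).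
  by rewrite ler_wpM2r// powR_ge0.
apply: (@blowup_construction R (freq N0 b) b nu alpha sg dl s) => //.
- exact: freq_ge1.
- exact: freq_leS.
- exact: freqS.
- lra.
- by rewrite -/beta; lra.
- by move=> k; apply: small; rewrite /K -/e; nra.
- by move=> k; apply: small; rewrite /K -/e -/beta; nra.
- by move=> k; apply: small; rewrite /K -/e -/beta; nra.
- by move=> k; apply: small; rewrite /K -/e -/beta; nra.
- by move=> k; apply: small; rewrite /K -/e -/beta; nra.
- by apply: freq_powR_unbounded => //; rewrite subr_gt0.
Qed.
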